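(* Let $F(x)=\sum_{n=1}^\infty\frac{e(n^2x)}{n}$. There exists an absolute constant $C>0$ such that for any interval $I=I_{p/q}$ and any $\lambda>0$ $$\big|\{x\in I:\ |F(x)-F_I|>\lambda\}\big|\le C\,|I|\,e^{-\lambda\sqrt{2q}} .$$
   Context: Notation: $e(x):=e^{2\pi i x}$; $|A|$ denotes Lebesgue measure of a set $A$. The function $F$ is in $L^2(\mathbb{T})$ and its series converges almost everywhere; $F_I=|I|^{-1}\int_I F$ is the average of $F$ on $I$. For an irreducible fraction $p/q=[0;a_1,a_2,\dots,a_{j_0}]$ (simple continued fraction with positive integer partial quotients $a_i$, of length $j_0\ge 0$), $I_{p/q}$ denotes the interval of numbers $x\in[0,1)$ whose convergents include those of $p/q$, i.e. the numbers of the form $x=[0;a_1,a_2,\dots,a_{j_0},\dots]$. Because $[0;a_1,\dots,a_{j_0}]=[0;a_1,\dots,a_{j_0}-1,1]$ when $a_{j_0}\neq1$, there are two possible choices of the continued fraction expansion of $p/q$; the interval $I_{p/q}$ is defined after fixing one of them, and the result holds irrespectively of this choice. *)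

(* Defs.v *)
From HB Require Import structures.
From mathcomp Require Import all_boot all_order all_algebra.
From mathcomp Require Import all_classical all_reals all_analysis.
From mathcomp Require Import complex.

Set Implicit Arguments.
Unset Strict Implicit.
Unset Printing Implicit Defensive.

Import Order.TTheory GRing.Theory Num.Theory.
Import numFieldNormedType.Exports.

Local Open Scope classical_set_scope.
Local Open Scope ring_scope.
Local Open Scope complex_scope.

Definition e (R : realType) (x : R) : R[i] :=
  cos (2 * pi * x) +i* sin (2 * pi * x).

(* The alias R[i]^o carries the usual topology of the complex plane. Where the
   series diverges, [limn] is a fixed default value; this happens only on a
   Lebesgue-null set. *)
Definition F (R : realType) (x : R) : R[i] :=
  limn (fun N : nat =>
    (\sum_(1 <= n < N.+1) e ((n ^ 2)%:R * x) / n%:R) : R[i]^o).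

(* The library integrates real-valued functions only, so the integral of a
   complex-valued function is taken componentwise. *)
Definition cintegral (R : realType) (I : set R) (f : R -> R[i]) : R[i] :=
  (\int[lebesgue_measure]_(x in I) complex.Re (f x))%R +i*
  (\int[lebesgue_measure]_(x in I) complex.Im (f x))%R.

Definition average (R : realType) (I : set R) (f : R -> R[i]) : R[i] :=
  ((fine (lebesgue_measure I))^-1)%:C * cintegral I f.

(* cfrac R [:: a_1; ...; a_j] = [0; a_1, ..., a_j] *)
Fixpoint cfrac (R : realType) (a : seq nat) : R :=
  if a is a1 :: a' then (a1%:R + cfrac R a')^-1 else 0.

(* x = [0; a_1, ..., a_j, ...], where the continuation is a (possibly empty)
   finite sequence or an infinite sequence of positive integers. *)
Definition cf_starts_with (R : realType) (a : seq nat) (x : R) : Prop :=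
  (exists b : seq nat, all (leq 1) b /\ x = cfrac R (a ++ b)) \/
  (exists b : nat -> nat, (forall n, 0 < b n)%N /\
     cfrac R (a ++ mkseq b n) @[n --> \oo] --> x).

(* The interval I_{p/q} attached to the chosen expansion a of p/q. *)
Definition cf_interval (R : realType) (a : seq nat) : set R :=
  [set x : R | 0 <= x < 1 /\ cf_starts_with a x].
Arguments cf_interval : clear implicits.

(* Main.v *)
Require Import Defs.
From HB Require Import structures.
From mathcomp Require Import all_boot all_order all_algebra.
From mathcomp Require Import all_classical all_reals all_analysis.
From mathcomp Require Import measurable_realfun.
From mathcomp Require Import complex.
From mathcomp Require Import zify ring lra.

(** Write [W_n(x)] for the sum of [e(m^2 x)] over [m <= n] and [V_n = W_1 + ... + W_n].
    Two summations by parts turn the series into the sum of [2 V_n / (n(n+1)(n+2))],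
    and these smoothed sums are completely elementary.  At a rational point,
    [2 V_n(p/q) + n + 1] is the sum of [e((a-b)^2 p/q)] over [0 <= a, b <= n];
    expanding in characters mod [q] gives nonnegative weights against Gauss sums, all
    of modulus at most [sqrt(2q)], whence
    [|V_n(p/q)| <= n^2 / sqrt(2q) + O(n sqrt q)] without logarithms.  Summation by
    parts carries this to [x] as long as [n^2 |x - p/q| <= 1].

    Let [q_k] be the denominators of the convergents of [x].  For
    [q_k <= n <= sqrt(q_k q_(k+1))] one uses the bound at the [k]-th convergent, for
    [sqrt(q_k q_(k+1)) <= n < q_(k+1)] the one at the next convergent; the block
    contributes [log(q_(k+1)/q_k) / sqrt(2 q_k) + O(1/sqrt q_k)].  So on [I_(p/q)],
    with [q_0 = q], [F] differs from a constant by at most [(Z + O(1)) / sqrt(2q)],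
    where [Z] is the sum of [sqrt(q_0/q_k) log(q_(k+1)/q_k)].

    Finally [Z = log b + b^(-1/2) Z'] with [b = q_1/q_0] and [Z'] the same quantity one
    step further, and the intervals with first digit [c] have relative length about
    [1/c^2].  Induction on the number of steps yields
    [|{Z > t}| <= C e^(-t) |I|]: the digit 1 loses a factor at most
    [(1 + rho)/(2 + rho) <= 2/3], where [rho <= 1] is the ratio of the two previous
    denominators, and larger digits leave an exponent [sqrt b > 1]. *)

Set Implicit Arguments.
Unset Strict Implicit.
Unset Printing Implicit Defensive.

Import Order.TTheory GRing.Theory Num.Theory.
Import numFieldNormedType.Exports.
Import Normc.

Local Open Scope classical_set_scope.
Local Open Scope ring_scope.
Local Open Scope complex_scope.

(** * Exponentials and complex moduli *)

Lemma normc_ge0 {R : rcfType} (z : R[i]) : 0 <= normc z.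
Proof. by case: z => a b; exact: sqrtr_ge0. Qed.

Lemma normc_sum {R : rcfType} (I : Type) (r : seq I) (P : pred I) (f : I -> R[i]) :
  normc (\sum_(i <- r | P i) f i) <= \sum_(i <- r | P i) normc (f i).
Proof.
elim/big_ind2: _ => [|x u y v hx hy|i _]; rewrite ?normc0 //.
by rewrite (le_trans (le_normcD _ _)) // lerD.
Qed.

Lemma normc_real {R : rcfType} (x : R) : normc x%:C = `|x|.
Proof. by rewrite /= expr0n addr0 sqrtr_sqr. Qed.

Lemma normc_nat {R : rcfType} (n : nat) : normc (n%:R : R[i]) = n%:R.
Proof.
by rewrite -(rmorph_nat (real_complex R)) normc_real ger0_norm // ler0n.
Qed.

Lemma normc_leB {R : rcfType} (x y : R[i]) : normc x <= normc y + normc (x - y).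
Proof. by rewrite -[in leLHS](subrK y x) addrC le_normcD. Qed.

Lemma normr_Re_le {R : rcfType} (z : R[i]) : `|complex.Re z| <= normc z.
Proof.
case: z => a b /=; rewrite -sqrtr_sqr ler_sqrt ?addr_ge0 ?sqr_ge0 //.
by rewrite lerDl sqr_ge0.
Qed.

Lemma normr_Im_le {R : rcfType} (z : R[i]) : `|complex.Im z| <= normc z.
Proof.
case: z => a b /=; rewrite -sqrtr_sqr ler_sqrt ?addr_ge0 ?sqr_ge0 //.
by rewrite lerDr sqr_ge0.
Qed.

Lemma normc_le_ReIm {R : rcfType} (z : R[i]) :
  normc z <= `|complex.Re z| + `|complex.Im z|.
Proof.
case: z => a b /=.
rewrite -[leRHS]ger0_norm ?addr_ge0 // -[leRHS]sqrtr_sqr ler_sqrt ?sqr_ge0 //.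
rewrite [leRHS]sqrrD !real_normK ?num_real //.
by rewrite [leRHS]addrAC lerDl mulrn_wge0 // mulr_ge0.
Qed.

Lemma conjc_normc {R : rcfType} (z : R[i]) : z * conjc z = (normc z ^+ 2)%:C.
Proof.
case: z => a b; rewrite /= sqr_sqrtr ?addr_ge0 ?sqr_ge0 //.
by apply/eqP; rewrite eq_complex /=; apply/andP; split; apply/eqP; ring.
Qed.

Lemma eD {R : realType} (x y : R) : e (x + y) = e x * e y.
Proof.
rewrite /e mulrDr cosD sinD.
by apply/eqP; rewrite eq_complex /=; apply/andP; split; apply/eqP; ring.
Qed.

Lemma e0 {R : realType} : e (0 : R) = 1.
Proof. by rewrite /e mulr0 cos0 sin0. Qed.

Lemma eN {R : realType} (x : R) : e (- x) = conjc (e x).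
Proof. by rewrite /e mulrN cosN sinN. Qed.

Lemma normc_e {R : realType} (x : R) : normc (e x) = 1.
Proof. by rewrite /= cos2Dsin2 sqrtr1. Qed.

Lemma eM_nat {R : realType} (x : R) (n : nat) : e (n%:R * x) = e x ^+ n.
Proof.
elim: n => [|n IH]; first by rewrite mul0r e0.
by rewrite -[n.+1]addn1 natrD mulrDl mul1r eD IH exprD expr1.
Qed.

Lemma e1 {R : realType} : e (1 : R) = 1.
Proof. by rewrite /e mulr1 mulr_natl cos2pi sin2pi. Qed.

Lemma e_nat {R : realType} (n : nat) : e (n%:R : R) = 1.
Proof. by rewrite -[n%:R]mulr1 eM_nat e1 expr1n. Qed.

Lemma e_natB {R : realType} (m n : nat) : e (m%:R - n%:R : R) = 1.
Proof. by rewrite eD eN !e_nat conjc1 mulr1. Qed.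

(** The real part is [1 - 2 sin^2(pi x)], and [sin (pi x)] is positive for such [x]. *)
Lemma e_neq1 {R : realType} (x : R) : 0 < x < 1 -> e x != 1.
Proof.
move=> /andP[x0 x1]; apply/eqP => /(congr1 (@complex.Re R)) /=.
have -> : 2 * pi * x = (pi * x) *+ 2 by rewrite -mulr_natl; ring.
have : 0 < sin (pi * x :> R).
  by rewrite sin_gt0_pi // mulr_gt0 ?pi_gt0 //= gtr_pMr ?pi_gt0.
move: (cos2Dsin2 (pi * x)); rewrite cos_mulr2n.
nra.
Qed.

Lemma sin_le_self {R : realType} (x : R) : 0 <= x -> sin x <= x.
Proof.
move=> x0.
have [->|xn0] := eqVneq x 0; first by rewrite sin0.
have x0' : 0 < x by rewrite lt_def xn0.
have [c _ hc] := @MVT R sin cos 0 x x0' (fun y _ => is_derive_sin y)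
   (continuous_subspaceT (@continuous_sin R)).
by move: hc; rewrite sin0 !subr0 => ->; rewrite ler_piMl // cos_le1.
Qed.

Lemma normr_sin_le {R : realType} (x : R) : `|sin x| <= `|x|.
Proof.
wlog x0 : x / 0 <= x.
  move=> H; have [/H//|/ltW x0] := leP 0 x.
  by rewrite -normrN -sinN -[leRHS]normrN H // oppr_ge0.
have h1 := sin_le_self x0.
rewrite (ger0_norm x0) ler_norml h1 andbT.
have [x1|x1] := leP x pi.
  by rewrite (@le_trans _ _ 0) ?oppr_le0 // sin_ge0_pi // x0.
by rewrite (le_trans _ (sin_geN1 x)) // lerN2; have := @pi_ge2 R; lra.
Qed.

Lemma normc_e_sub1 {R : realType} (x : R) : normc (e x - 1) = 2 * `|sin (pi * x)|.
Proof.
rewrite /e /=.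
have -> : 2 * pi * x = (pi * x) *+ 2 by rewrite -mulr_natl; ring.
rewrite cos_mulr2n sin_mulr2n subr0.
have h := cos2Dsin2 (pi * x).
move: h; set c := cos _; set s := sin _ => h.
have -> : (c ^+ 2 *+ 2 - 1 - 1) ^+ 2 + (c * s *+ 2) ^+ 2 = (2 * s) ^+ 2.
  apply/eqP; rewrite -subr_eq0; apply/eqP.
  (* The two sides differ by a multiple of [c^2 + s^2 - 1]. *)
  transitivity (4 * (c ^+ 2 - 1) * (c ^+ 2 + s ^+ 2 - 1)); first by ring.
  by rewrite h subrr mulr0.
by rewrite sqrtr_sqr normrM ger0_norm.
Qed.

(** The constant [8] is a crude form of [2 pi], from [pi < 4]. *)
Lemma normc_e_sub1_le {R : realType} (x : R) : normc (e x - 1) <= 8 * `|x|.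
Proof.
rewrite normc_e_sub1 (le_trans (ler_pM _ _ (lexx _) (normr_sin_le _))) //.
rewrite normrM (ger0_norm (@pi_ge0 R)) mulrA ler_wpM2r //.
have := @pihalf_lt2 R; lra.
Qed.

(** * Quadratic Gauss sums *)

Lemma e_addB {R : realType} (x : R) (m n : nat) : e (x + (m%:R - n%:R)) = e x.
Proof. by rewrite eD e_natB mulr1. Qed.

(** Dropping the integer quotients leaves two residues in [[0, q)]; if distinct, they differ by a
    fraction of modulus strictly between 0 and 1, where [e] is not 1. *)
Lemma e_frac_eq1 {R : realType} (q a b : nat) : (0 < q)%N ->
  (e ((a%:R - b%:R) / q%:R : R) == 1) = (a == b %[mod q]).
Proof.
move=> q0; have qr : (q%:R : R) != 0 by rewrite pnatr_eq0 -lt0n.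
have q0' : 0 < (q%:R : R) by rewrite ltr0n.
have -> : (a%:R - b%:R) / q%:R =
    ((a %% q)%:R - (b %% q)%:R) / q%:R + ((a %/ q)%:R - (b %/ q)%:R) :> R.
  rewrite {1}(divn_eq a q) {1}(divn_eq b q) !natrD !natrM; field.
  by [].
rewrite e_addB.
have : (a %% q < q)%N by rewrite ltn_mod.
have : (b %% q < q)%N by rewrite ltn_mod.
move: (a %% q)%N (b %% q)%N => {a b} a b bq aq.
have H c d : (d < c)%N -> (c < q)%N -> e ((c%:R - d%:R) / q%:R : R) != 1.
  move=> dc cq; apply: e_neq1; rewrite divr_gt0 ?subr_gt0 ?ltr_nat //=.
  rewrite ltr_pdivrMr // mul1r ltrBlDr (lt_le_trans (_ : _ < q%:R)) ?ltr_nat //.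
  by rewrite lerDl ler0n.
have [ab|ab|->] := ltngtP a b; last by rewrite subrr mul0r e0 eqxx.
  apply/negbTE; rewrite -[_ / _]opprK eN -mulNr opprB; apply: contra (H _ _ ab bq).
  by move=> /eqP h; rewrite -[e _]conjcK h conjc1.
by apply/negbTE; apply: H.
Qed.

Lemma e_orth {R : realType} (q a b : nat) : (0 < q)%N ->
  \sum_(t < q) e (t%:R * ((a%:R - b%:R) / q%:R) : R) =
  if a == b %[mod q] then q%:R else 0.
Proof.
move=> q0; have qr : (q%:R : R) != 0 by rewrite pnatr_eq0 -lt0n.
rewrite -(e_frac_eq1 (R := R)) //.
set z := e ((a%:R - b%:R) / q%:R).
rewrite (eq_bigr (fun t : 'I_q => z ^+ t)); last by move=> t _; rewrite eM_nat.
have [->|z1] := eqVneq z 1.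
  rewrite (eq_bigr (fun=> 1)); last by move=> i _; rewrite expr1n.
  by rewrite sumr_const card_ord.
have zq : z ^+ q = 1.
  by rewrite -eM_nat mulrCA mulrV ?unitfE // mulr1 e_natB.
apply/eqP; rewrite -(mulrI_eq0 _ (lregP (_ : z - 1 != 0))) ?subr_eq0 //.
by rewrite -subrX1 zq subrr.
Qed.

Lemma sum_periodic_shift {V : zmodType} (q : nat) (f : nat -> V) (h : nat) :
  (forall r, f (r + q)%N = f r) ->
  \sum_(r < q) f (r + h)%N = \sum_(r < q) f r.
Proof.
move=> fq; elim: h => [|h IH].
  by apply: eq_bigr => r _; rewrite addn0.
rewrite -IH; case: q fq IH => [|q] fq _; first by rewrite !big_ord0.
rewrite big_ord_recr big_ord_recl /=.
have -> : (q + h.+1 = h + q.+1)%N by lia.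
rewrite fq addrC add0n; congr (_ + _); apply: eq_bigr => i _.
by rewrite /bump /= add1n addSnnS.
Qed.

(** A multiple of [q] below [2 q] is [0] or [q]. These two solutions are the source of the factor 2
    in the Gauss sum bound. *)
Lemma card_double_dvd (q : nat) : (0 < q)%N ->
  (#|[pred h : 'I_q | (q %| 2 * h)%N]| <= 2)%N.
Proof.
move=> q0.
case: q q0 => // q _.
have h0 : [pred h : 'I_q.+1 | (q.+1 %| 2 * h)%N] \subset
    pred2 ord0 (inord q.+1./2).
  apply/fintype.subsetP => h; rewrite !inE /= => /dvdnP [k hk].
  have hq := ltn_ord h.
  have kl : (k < 2)%N by rewrite -(ltn_pmul2r (ltn0Sn q)) -hk ltn_pmul2l.
  case: k kl hk => [|[|//]] _ hk; apply/orP; [left|right]; apply/eqP/val_inj => /=.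
    by lia.
  by rewrite inordK; lia.
rewrite (leq_trans (subset_leq_card h0)) // card2.
by case: (_ == _).
Qed.

Definition gauss {R : realType} (p q t : nat) : R[i] :=
  \sum_(r < q) e ((p * r ^ 2 + t * r)%:R / q%:R).

(** The correlation at distance [h] is a phase times a linear character in [r]; the term [0%:R]
    gives it the shape of [e_orth]. *)
Lemma gauss_shift {R : realType} (p q t r h : nat) : (0 < q)%N ->
  e ((p * (r + h) ^ 2 + t * (r + h))%:R / q%:R : R)
     * conjc (e ((p * r ^ 2 + t * r)%:R / q%:R : R)) =
  e ((p * h ^ 2 + t * h)%:R / q%:R) * e (r%:R * (((2 * p * h)%:R - 0%:R) / q%:R)).
Proof.
move=> q0; have qr : (q%:R : R) != 0 by rewrite pnatr_eq0 -lt0n.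
rewrite -eN -!eD; congr e.
rewrite !(natrD, natrM, natrX); field.
by [].
Qed.

(** Weyl differencing: the square is a sum over differences [h], whose inner sum over [r] vanishes
    unless [q] divides [2 p h], hence [2 h]. At most two [h] survive, each contributing at most
    [q]. *)
Lemma gauss_sqr_le {R : realType} (p q t : nat) : (0 < q)%N -> coprime p q ->
  normc (gauss p q t : R[i]) ^+ 2 <= 2 * q%:R.
Proof.
move=> q0 pq; have qr : (q%:R : R) != 0 by rewrite pnatr_eq0 -lt0n.
have H : (normc (gauss p q t : R[i]) ^+ 2)%:C =
   \sum_(h < q) e ((p * h ^ 2 + t * h)%:R / q%:R) *
      (if (2 * p * h)%N == 0%N %[mod q] then q%:R else 0).
  rewrite -conjc_normc {2}/gauss rmorph_sum mulr_sumr.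
  (* By periodicity the first factor may start at [r], which turns pairs into differences [h]. *)
  have hs (r : nat) : gauss p q t = \sum_(h < q)
      e ((p * (h + r) ^ 2 + t * (h + r))%:R / q%:R) :> R[i].
    rewrite (@sum_periodic_shift _ q
      (fun r => e ((p * r ^ 2 + t * r)%:R / q%:R) : R[i])) // => s.
    have -> : (p * (s + q) ^ 2 + t * (s + q))%:R / q%:R =
         (p * s ^ 2 + t * s)%:R / q%:R
         + ((2 * p * s + p * q + t)%:R - 0%:R) :> R.
      by rewrite !(natrD, natrM, natrX); field.
    exact: e_addB.
  under eq_bigr => r _ do rewrite (hs (nat_of_ord r)) mulr_suml.
  rewrite exchange_big; apply: eq_bigr => h _.
  rewrite -e_orth // mulr_sumr; apply: eq_bigr => r _.
  by rewrite (addnC h r) gauss_shift.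
rewrite -[leLHS]ger0_norm ?sqr_ge0 // -normc_real H.
rewrite (le_trans (normc_sum _ _ _)) //.
rewrite (le_trans (_ : _ <= \sum_(h < q) (if (q %| 2 * h)%N then q%:R else 0))) //.
  apply: ler_sum => h _; rewrite normcM normc_e mul1r mod0n.
  rewrite -/(dvdn q (2 * p * h)) -mulnA mulnCA Gauss_dvdr 1?coprime_sym //.
  by case: ifP => _; rewrite ?normc_nat ?normc0.
rewrite -big_mkcond /= sumr_const -[leLHS]mulr_natl ler_wpM2r ?ler0n // ler_nat.
exact: card_double_dvd.
Qed.

Lemma gauss_le {R : realType} (p q t : nat) : (0 < q)%N -> coprime p q ->
  normc (gauss p q t : R[i]) <= Num.sqrt (2 * q%:R).
Proof.
move=> q0 pq; rewrite -[leLHS]ger0_norm ?normc_ge0 // -sqrtr_sqr ler_sqrt.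
  exact: gauss_sqr_le.
by rewrite mulr_ge0 ?ler0n.
Qed.

(** * Iterated Weyl sums at rational points *)

Definition weyl {R : realType} (x : R) (n : nat) : R[i] :=
  \sum_(1 <= m < n.+1) e ((m ^ 2)%:R * x).

Definition iweyl {R : realType} (x : R) (n : nat) : R[i] :=
  \sum_(1 <= m < n.+1) weyl x m.

Lemma weylS {R : realType} (x : R) n :
  weyl x n.+1 = weyl x n + e ((n.+1 ^ 2)%:R * x).
Proof. by rewrite /weyl big_nat_recr. Qed.

Lemma iweylS {R : realType} (x : R) n : iweyl x n.+1 = iweyl x n + weyl x n.+1.
Proof. by rewrite /iweyl big_nat_recr. Qed.

Lemma iweyl0 {R : realType} (x : R) : iweyl x 0 = 0.
Proof. by rewrite /iweyl big_geq. Qed.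

Lemma weyl_reflect {R : realType} (x : R) n :
  \sum_(a < n) e ((a%:R - n%:R) ^+ 2 * x) = weyl x n.
Proof.
rewrite /weyl big_add1 /= big_nat_rev /= big_mkord; apply: eq_bigr => a _.
rewrite add0n subnSK // natrX natrB 1?ltnW //; congr (e (_ * x)).
by rewrite -sqrrN opprB.
Qed.

(** The new index [n.+1] adds a row and a column, each equal to [weyl x n.+1], and one diagonal
    entry 1. *)
Lemma fejer_sum {R : realType} (x : R) n :
  \sum_(a < n.+1) \sum_(b < n.+1) e ((a%:R - b%:R) ^+ 2 * x) =
  n.+1%:R + 2 * iweyl x n.
Proof.
elim: n => [|n IH].
  by rewrite !big_ord_recl !big_ord0 iweyl0 subrr expr0n mul0r e0 mulr0 !addr0.
rewrite big_ord_recr /=.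
under eq_bigr do rewrite big_ord_recr /=.
rewrite big_split /= IH weyl_reflect big_ord_recr /= subrr expr0n mul0r e0.
rewrite (eq_bigr (fun b : 'I_n.+1 => e ((b%:R - n.+1%:R) ^+ 2 * x))); last first.
  by move=> b _; rewrite -sqrrN opprB.
have -> : n.+2%:R = n.+1%:R + 1 :> R[i] by rewrite -natr1.
by rewrite weyl_reflect iweylS; ring.
Qed.

(** Fourier inversion on the residues mod [q]: summing over [t] first singles out the residue
    [r = a - b]. *)
Lemma e_gauss {R : realType} (p q a b : nat) : (0 < q)%N ->
  q%:R * e ((a%:R - b%:R) ^+ 2 * (p%:R / q%:R) : R) =
  \sum_(t < q) gauss p q t * e (t%:R * ((b%:R - a%:R) / q%:R)).
Proof.
move=> q0; have qr : (q%:R : R) != 0 by rewrite pnatr_eq0 -lt0n.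
transitivity (\sum_(r < q) e ((p * r ^ 2)%:R / q%:R : R) *
   (if (r + b)%N == a %[mod q] then q%:R else 0)); last first.
  under [RHS]eq_bigr => t _ do rewrite mulr_suml.
  rewrite exchange_big; apply: eq_bigr => r _.
  rewrite -e_orth // mulr_sumr; apply: eq_bigr => t _.
  rewrite -!eD; congr e; rewrite !(natrD, natrM, natrX); field.
  by [].
(* The residue of [a - b], formed without negative numbers. *)
pose r0 := Ordinal (ltn_pmod (a + (q - b %% q)) q0).
have hr0 : (r0 + b = a %[mod q])%N.
  rewrite /= modnDml -modnDmr.
  have -> : (a + (q - b %% q) + b %% q = a + q)%N.
    by have := ltn_pmod b q0; lia.
  by rewrite modnDr.
rewrite (bigD1 r0) // big1; last first.
  move=> r /= rr0; case: ifPn => [hr|_]; last by rewrite mulr0.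
  case/negP: rr0; apply/eqP/val_inj; move: hr; rewrite -hr0.
  by rewrite eqn_modDr !modn_small ?ltn_ord // => /eqP.
rewrite [RHS]addr0 ifT; last by apply/eqP.
rewrite mulrC; congr (_ * _).
move: hr0; rewrite -/(nat_of_ord r0); move: (nat_of_ord r0) => r hr.
have hA := divn_eq a q; have hB := divn_eq (r + b) q; rewrite -hr in hA.
set m := (a %/ q)%N in hA; set n := ((r + b) %/ q)%N in hB.
have hab : a%:R - b%:R = r%:R + (m%:R - n%:R) * q%:R :> R.
  have : (a + n * q = r + b + m * q)%N by lia.
  move/(congr1 (fun k => k%:R : R)); rewrite !natrD !natrM => h.
  by rewrite mulrBl; lra.
rewrite hab.
(* Passing from [a - b] to [r] changes the phase by an integer, written as a difference of naturals
   for [e_addB]. *)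
have -> : (r%:R + (m%:R - n%:R) * q%:R) ^+ 2 * (p%:R / q%:R) =
  (p * r ^ 2)%:R / q%:R + ((2 * p * r * m + p * q * (m ^ 2 + n ^ 2))%:R -
     (2 * p * r * n + 2 * p * q * m * n)%:R) :> R.
  by rewrite !(natrD, natrM, natrX); field.
by rewrite e_addB.
Qed.

(** Each character enters through a squared modulus. The weights on the Gauss sums are thus
    nonnegative, and the triangle inequality can be followed by an exact evaluation of the total
    weight. *)
Lemma gauss_fejer {R : realType} (p q n : nat) : (0 < q)%N ->
  q%:R * (n.+1%:R + 2 * iweyl (p%:R / q%:R : R) n) =
  \sum_(t < q) gauss p q t *
    (normc (\sum_(b < n.+1) e (t%:R * (b%:R / q%:R) : R)) ^+ 2)%:C.
Proof.
move=> q0; rewrite -fejer_sum mulr_sumr.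
under eq_bigr => a _ do
  (rewrite mulr_sumr; under eq_bigr => b _ do rewrite e_gauss //).
under eq_bigr => a _ do rewrite exchange_big /=.
rewrite exchange_big /=; apply: eq_bigr => t _.
rewrite -conjc_normc rmorph_sum big_distrlr mulr_sumr exchange_big.
apply: eq_bigr => b _; rewrite mulr_sumr; apply: eq_bigr => a _; congr (_ * _).
transitivity (e (t%:R * (b%:R / q%:R)) * conjc (e (t%:R * (a%:R / q%:R) : R))) => //.
rewrite -eN -eD; congr e; field.
by rewrite pnatr_eq0 -lt0n.
Qed.

Definition congr_pairs (q n : nat) : nat :=
  (\sum_(b < n.+1) \sum_(a < n.+1) (a == b %[mod q]))%N.

(** Parseval on the residues mod [q]. *)
Lemma fejer_square_sum {R : realType} (q n : nat) : (0 < q)%N ->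
  \sum_(t < q) normc (\sum_(b < n.+1) e (t%:R * (b%:R / q%:R) : R)) ^+ 2 =
  q%:R * (congr_pairs q n)%:R.
Proof.
move=> q0; apply: (@complexI R); rewrite rmorph_sum.
transitivity (\sum_(t < q) \sum_(b < n.+1) \sum_(a < n.+1)
    e (t%:R * (b%:R / q%:R)) * conjc (e (t%:R * (a%:R / q%:R) : R))).
  by apply: eq_bigr => t _; rewrite -[LHS]conjc_normc rmorph_sum big_distrlr.
rewrite exchange_big rmorphM !rmorph_nat natr_sum mulr_sumr.
apply: eq_bigr => b _; rewrite exchange_big natr_sum mulr_sumr.
apply: eq_bigr => a _.
transitivity (if b == a %[mod q] then q%:R else 0 : R[i]); last first.
  by rewrite eq_sym; case: ifP => _; rewrite ?mulr1 ?mulr0.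
rewrite -e_orth //; apply: eq_bigr => t _.
rewrite -eN -eD; congr e; field.
by rewrite pnatr_eq0 -lt0n.
Qed.

(** For fixed [b], each block of [q] consecutive integers holds exactly one congruent [a], and
    [(n %/ q).+1] blocks cover [[0, n]]. *)
Lemma congr_pairs_le (q n : nat) : (0 < q)%N ->
  (congr_pairs q n <= n.+1 * (n %/ q).+1)%N.
Proof.
move=> q0; rewrite /congr_pairs.
rewrite (leq_trans (_ : _ <= \sum_(b < n.+1) (n %/ q).+1)%N) //; last first.
  by rewrite sum_nat_const card_ord.
apply: leq_sum => b _.
have H k : (\sum_(0 <= a < k * q) (a == b %[mod q]) = k)%N.
  elim: k => [|k IH]; first by rewrite big_geq.
  rewrite mulSn addnC (@big_cat_nat _ _ _ (k * q)) ?leq_addr //= IH.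
  rewrite -{1}[(k * q)%N]add0n big_addn addKn big_mkord -[RHS]addn1.
  rewrite (bigD1 (Ordinal (ltn_pmod b q0))) //= big1 => [|i ib].
    by rewrite (addnC (b %% q)%N) modnMDl modn_mod eqxx.
  rewrite (addnC (i : nat)) modnMDl; apply/eqP; rewrite eqb0; apply: contra ib => /eqP h.
  by apply/eqP/val_inj; rewrite /= -h modn_small.
rewrite -[leqRHS]H -(big_mkord xpredT (fun a => nat_of_bool (a == b %[mod q]))).
rewrite [leqRHS](@big_cat_nat _ _ _ n.+1) ?leq_addr //=.
by rewrite {1}(divn_eq n q) mulSn addnC ltn_add2r ltn_mod.
Qed.

(** The Gauss bound times the total weight is [sqrt (2 q) (n + 1) (n / q + 1)] for the full square.
    Half of its leading part [sqrt (2 q) n^2 / q] is exactly [n^2 / sqrt (2 q)], the constant that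
    fixes the final exponent; the rest is of order [n sqrt q]. *)
Lemma iweyl_rational_le {R : realType} (p q n : nat) : (0 < q)%N -> coprime p q ->
  normc (iweyl (p%:R / q%:R : R) n) <=
  n%:R ^+ 2 / Num.sqrt (2 * q%:R) + 4 * n%:R * Num.sqrt q%:R.
Proof.
move=> q0 pq; have qr : 0 < (q%:R : R) by rewrite ltr0n.
case: n => [|n]; first by rewrite iweyl0 normc0 expr0n mul0r mulr0 mul0r addr0.
have n1 : 1 <= (n.+1%:R : R) by rewrite ler1n.
move: (n.+1) (ltn0Sn n) n1 => {}n n0 n1.
have sq1 : 1 <= Num.sqrt (q%:R : R) by rewrite -[leLHS]sqrtr1 ler_sqrt ?ler1n.
have s2 : Num.sqrt (2 * q%:R : R) = Num.sqrt 2 * Num.sqrt q%:R by rewrite sqrtrM.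
have s22 : (Num.sqrt 2 : R) ^+ 2 = 2 by rewrite sqr_sqrtr.
have s2p : 0 < Num.sqrt (2 : R) by rewrite sqrtr_gt0.
have sqq : Num.sqrt (q%:R : R) ^+ 2 = q%:R by rewrite sqr_sqrtr // ltW.
have H : q%:R * normc (n.+1%:R + 2 * iweyl (p%:R / q%:R : R) n) <=
    Num.sqrt (2 * q%:R) * (q%:R * (n.+1%:R * (n%:R / q%:R + 1))).
  rewrite -{1}(@normc_nat R q) -normcM gauss_fejer //.
  rewrite (le_trans (normc_sum _ _ _)) //.
  rewrite (le_trans (_ : _ <= Num.sqrt (2 * q%:R) * (q%:R * (congr_pairs q n)%:R))) //.
    rewrite -fejer_square_sum // mulr_sumr; apply: ler_sum => t _.
    rewrite normcM normc_real ger0_norm ?sqr_ge0 //.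
    by rewrite ler_wpM2r ?sqr_ge0 // gauss_le.
  rewrite ler_wpM2l ?sqrtr_ge0 // ler_wpM2l ?ler0n //.
  rewrite (le_trans (_ : _ <= (n.+1 * (n %/ q).+1)%:R)) ?ler_nat ?congr_pairs_le //.
  rewrite natrM ler_wpM2l ?ler0n // -natr1 lerD2r.
  by rewrite ler_pdivlMr // -natrM ler_nat leq_trunc_div.
have H1 : normc (n.+1%:R + 2 * iweyl (p%:R / q%:R : R) n) <=
    Num.sqrt (2 * q%:R) * (n.+1%:R * (n%:R / q%:R + 1)).
  by rewrite -(ler_pM2l qr) (le_trans H) // mulrCA.
have H2 : 2 * normc (iweyl (p%:R / q%:R : R) n) <=
   n.+1%:R + normc (n.+1%:R + 2 * iweyl (p%:R / q%:R : R) n).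
  rewrite -{1}(@normc_nat R 2) -normcM -{1}(@normc_nat R n.+1).
  rewrite -[X in normc X <= _](addKr (n.+1%:R)) (le_trans (le_normcD _ _)) //.
  by rewrite normcN.
move: H1 H2; rewrite s2 -(natr1 n : _ = _ :> R); set w := normc (iweyl _ _); set N := normc _.
set s := Num.sqrt q%:R in sq1 sqq s2 *; set r := Num.sqrt 2 in s22 s2p s2 *.
move=> H1 H2.
have r2 : r <= 3 / 2 by nra.
have r1 : 1 <= r by nra.
have -> : n%:R ^+ 2 / (r * s) = r * n%:R ^+ 2 / s / 2.
  by rewrite -[in RHS]s22; field; rewrite !gt_eqF // (lt_le_trans ltr01).
have E : r * s * ((n%:R + 1) * (n%:R / q%:R + 1)) =
  r * n%:R ^+ 2 / s + r * n%:R / s + r * s * (n%:R + 1).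
  by rewrite -sqq; field; rewrite gt_eqF // (lt_le_trans ltr01).
rewrite E in H1.
have hs : r * n%:R / s <= 3 / 2 * n%:R * s.
  rewrite ler_pdivrMr ?(lt_le_trans ltr01) //.
  have h1 : r * n%:R <= 3 / 2 * n%:R by rewrite ler_wpM2r.
  have h2 : n%:R <= n%:R * (s * s) by rewrite ler_peMr ?mulr_ege1.
  lra.
have h3 : r * s * (n%:R + 1) <= 3 * n%:R * s.
  rewrite mulrAC ler_wpM2r ?(le_trans ler01) //.
  rewrite (le_trans (ler_pM _ _ r2 (_ : _ <= 2 * n%:R))) ?(ltW s2p) ?addr_ge0 //; lra.
have h4 : n%:R <= n%:R * s by rewrite ler_peMr.
lra.
Qed.

(** * Perturbation of a rational point *)

Lemma sum_by_parts {A : comPzRingType} (g w : nat -> A) (n : nat) :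
  \sum_(1 <= m < n.+1) g m * w m =
  g n * (\sum_(1 <= m < n.+1) w m)
  - \sum_(1 <= m < n) (g m.+1 - g m) * (\sum_(1 <= k < m.+1) w k).
Proof.
elim: n => [|[|n] IH]; first by rewrite !big_geq // mulr0 subrr.
  by rewrite !big_nat1 big_geq // subr0.
rewrite big_nat_recr //= IH [in RHS]big_nat_recr //=.
rewrite [X in _ = _ - X]big_nat_recr //=; ring.
Qed.

Lemma iterated_sum {A : comPzRingType} (w : nat -> A) (n : nat) :
  \sum_(1 <= m < n.+1) \sum_(1 <= k < m.+1) w k =
  \sum_(1 <= m < n.+1) (n.+1%:R - m%:R) * w m.
Proof.
elim: n => [|n IH]; first by rewrite !big_geq.
rewrite big_nat_recr //= IH [in RHS]big_nat_recr //= [X in _ + X]big_nat_recr //=.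
rewrite addrA -big_split /=; congr (_ + _); last first.
  by rewrite -[n.+2%:R]natr1; ring.
by apply: eq_bigr => i _; rewrite -[n.+2%:R]natr1; ring.
Qed.

(* Summing by parts twice, with weights [g m = (n + 1 - m) * h m] that vanish
   at [m = n + 1]. *)
Lemma iterated_sum_by_parts {A : comPzRingType} (h w : nat -> A) (n : nat) :
  let g m := (n.+1%:R - m%:R) * h m in
  \sum_(1 <= m < n.+1) \sum_(1 <= k < m.+1) h k * w k =
  h n * (\sum_(1 <= m < n.+1) \sum_(1 <= k < m.+1) w k)
  + \sum_(1 <= m < n) (g m - g m.+1 *+ 2 + g m.+2) *
      (\sum_(1 <= k < m.+1) \sum_(1 <= j < k.+1) w j).
Proof.
move=> g; rewrite [LHS]iterated_sum.
rewrite (eq_bigr (fun m => g m * w m)); last by move=> m _; rewrite /g mulrA.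
rewrite (sum_by_parts g w).
have -> : g n * (\sum_(1 <= m < n.+1) w m) -
    \sum_(1 <= m < n) (g m.+1 - g m) * (\sum_(1 <= k < m.+1) w k) =
  \sum_(1 <= m < n.+1) (g m - g m.+1) * (\sum_(1 <= k < m.+1) w k).
  case: n @g => [|n] g; first by rewrite !big_geq // mulr0 subrr.
  have gn : g n.+2 = 0 by rewrite /g subrr mul0r.
  rewrite [RHS]big_nat_recr //= gn subr0 addrC; congr (_ + _).
  by rewrite -sumrN; apply: eq_bigr => i _; rewrite -mulNr opprB.
rewrite (sum_by_parts (fun m => g m - g m.+1)); congr (_ * _ + _).
  by rewrite /g subrr mul0r subr0 -natr1 addrAC subrr add0r mul1r.
rewrite -sumrN; apply: eq_bigr => i _; rewrite -mulNr; congr (_ * _).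
by rewrite mulr2n; ring.
Qed.

Lemma normc_e_diff {R : realType} (k : nat) (d : R) :
  normc (e ((k.+2 ^ 2)%:R * d) - e ((k ^ 2)%:R * d)) <= 32 * k.+1%:R * `|d|.
Proof.
(* Since [(k + 2)^2 - k^2 = 4 (k + 1)], the constant is [8 * 4 = 32]. *)
have -> : e ((k.+2 ^ 2)%:R * d) - e ((k ^ 2)%:R * d) =
   e ((k ^ 2)%:R * d) * (e ((4 * k.+1)%:R * d) - 1).
  rewrite mulrBr mulr1 -eD; congr (e _ - _).
  rewrite -mulrDl -natrD; congr (_%:R * _); lia.
rewrite normcM normc_e mul1r (le_trans (normc_e_sub1_le _)) //.
by rewrite normrM normr_nat natrM; lra.
Qed.

(** Factor out the middle term and put [y = 2 (k + 1) d]. What remains is a square of size [64 y^2],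
    at most [256 |d|] by the hypothesis, plus [2 (e d - 1)], at most [16 |d|]. *)
Lemma normc_e_diff2 {R : realType} (k : nat) (d : R) :
  k.+1%:R ^+ 2 * `|d| <= 1 ->
  normc (e ((k ^ 2)%:R * d) - e ((k.+1 ^ 2)%:R * d) *+ 2 + e ((k.+2 ^ 2)%:R * d))
    <= 272 * `|d|.
Proof.
move=> kd; set y := (2 * k.+1)%:R * d.
have -> : e ((k ^ 2)%:R * d) - e ((k.+1 ^ 2)%:R * d) *+ 2 + e ((k.+2 ^ 2)%:R * d) =
   e ((k.+1 ^ 2)%:R * d) * (e d * (e (- y) * (e y - 1) ^+ 2) + (e d - 1) * 2).
  have -> : e ((k ^ 2)%:R * d) = e ((k.+1 ^ 2)%:R * d) * e d * e (- y).
    rewrite -!eD; congr e; rewrite /y.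
    by rewrite !(natrX, natrM) -[k.+1%:R]natr1; ring.
  have -> : e ((k.+2 ^ 2)%:R * d) = e ((k.+1 ^ 2)%:R * d) * e d * e y.
    rewrite -!eD; congr e; rewrite /y.
    by rewrite !(natrX, natrM) -[k.+2%:R]natr1 -[k.+1%:R]natr1; ring.
  have h : e (- y) * e y = 1 by rewrite -eD addNr e0.
  rewrite -mulr_natr.
  have -> : e (- y) * (e y - 1) ^+ 2 = e (- y) * e y * e y - 2 * (e (- y) * e y) + e (- y).
    by ring.
  by rewrite h; ring.
rewrite normcM normc_e mul1r (le_trans (le_normcD _ _)) // !normcM !normc_e !mul1r.
rewrite (@normc_nat R 2).
have h1 := normc_e_sub1_le d; have h2 := normc_e_sub1_le y.
have : normc (e y - 1) * normc (e y - 1) <= (8 * `|y|) * (8 * `|y|).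
  by rewrite ler_pM ?normc_ge0.
have -> : `|y| = 2 * k.+1%:R * `|d| by rewrite normrM normr_nat natrM.
have : k.+1%:R ^+ 2 * `|d| * `|d| <= `|d| by rewrite ler_piMl.
lra.
Qed.

(** The perturbation multiplies the [m]-th term by [e (m^2 d)], and two summations by parts move all
    differences onto this smooth factor. The boundary term costs [8 n^2 |d|], and fewer than [n]
    second differences cost [304 n |d|] each. *)
Lemma iweyl_perturb {R : realType} (x d B : R) (n : nat) :
  (forall m, (m <= n)%N -> normc (iweyl x m) <= B) ->
  n%:R ^+ 2 * `|d| <= 1 ->
  normc (iweyl (x + d) n - iweyl x n) <= 312 * (n%:R ^+ 2 * `|d|) * B.
Proof.
move=> HB nd.
have B0 : 0 <= B by apply: le_trans (HB 0%N isT); exact: normc_ge0.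
pose h m : R[i] := e ((m ^ 2)%:R * d) - 1.
pose w m : R[i] := e ((m ^ 2)%:R * x).
have -> : iweyl (x + d) n - iweyl x n =
   \sum_(1 <= m < n.+1) \sum_(1 <= k < m.+1) h k * w k.
  rewrite -sumrB; apply: eq_bigr => m _; rewrite -sumrB; apply: eq_bigr => k _.
  by rewrite /h /w mulrBl mul1r -eD mulrDr [X in e X]addrC.
rewrite iterated_sum_by_parts /=.
rewrite -[X in h n * X]/(iweyl x n) (le_trans (le_normcD _ _)) //.
have h1 : normc (h n * iweyl x n) <= 8 * (n%:R ^+ 2 * `|d|) * B.
  rewrite normcM ler_pM ?normc_ge0 ?HB // (le_trans (normc_e_sub1_le _)) //.
  by rewrite normrM normr_nat natrX.
have h2 : normc (\sum_(1 <= m < n) ((n.+1%:R - m%:R) * h m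
      - (n.+1%:R - m.+1%:R) * h m.+1 *+ 2 + (n.+1%:R - m.+2%:R) * h m.+2) *
    (iweyl x m)) <= \sum_(1 <= m < n) (304 * n%:R * `|d|) * B.
  rewrite (le_trans (normc_sum _ _ _)) // big_nat_cond [leRHS]big_nat_cond.
  apply: ler_sum => m /andP[/andP[m1 mn] _].
  rewrite normcM ler_pM ?normc_ge0 ?HB 1?ltnW //.
  (* Second difference of a product with a linear factor: a multiple of the second difference of
     [h], minus a two-step first difference. Hence [304 = 272 + 32]. *)
  have -> : (n.+1%:R - m%:R) * h m
      - (n.+1%:R - m.+1%:R) * h m.+1 *+ 2 + (n.+1%:R - m.+2%:R) * h m.+2 =
     (n - m)%:R * (h m - h m.+1 *+ 2 + h m.+2) - (h m.+2 - h m).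
    rewrite -[n.+1%:R]natr1 -[m.+2%:R]natr1 -[m.+1%:R]natr1 natrB 1?ltnW //.
    by ring.
  rewrite (le_trans (le_normcD _ _)) // normcN normcM normc_nat.
  have -> : h m.+2 - h m = e ((m.+2 ^ 2)%:R * d) - e ((m ^ 2)%:R * d).
    by rewrite /h; ring.
  have -> : h m - h m.+1 *+ 2 + h m.+2 =
     e ((m ^ 2)%:R * d) - e ((m.+1 ^ 2)%:R * d) *+ 2 + e ((m.+2 ^ 2)%:R * d).
    by rewrite /h; ring.
  have mn' : m.+1%:R <= n%:R :> R by rewrite ler_nat.
  have e1 : normc (e ((m.+2 ^ 2)%:R * d) - e ((m ^ 2)%:R * d)) <= 32 * n%:R * `|d|.
    rewrite (le_trans (normc_e_diff _ _)) // ler_wpM2r // ler_wpM2l //.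
  have e2 : normc (e ((m ^ 2)%:R * d) - e ((m.+1 ^ 2)%:R * d) *+ 2
               + e ((m.+2 ^ 2)%:R * d)) <= 272 * `|d|.
    apply: normc_e_diff2; rewrite (le_trans _ nd) // ler_wpM2r //.
    by rewrite lerXn2r ?nnegrE ?ler0n.
  have e3 : (n - m)%:R * normc (e ((m ^ 2)%:R * d) - e ((m.+1 ^ 2)%:R * d) *+ 2
               + e ((m.+2 ^ 2)%:R * d)) <= n%:R * (272 * `|d|).
    by rewrite ler_pM ?normc_ge0 ?ler0n // ler_nat leq_subr.
  lra.
rewrite (le_trans (lerD h1 h2)) // big_const_nat iter_addr_0 -mulr_natl.
have : (n - 1)%:R * (304 * n%:R * `|d| * B) <= n%:R * (304 * n%:R * `|d| * B).
  apply: ler_wpM2r; last by rewrite ler_nat leq_subr.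
  by rewrite -!mulrA mulr_ge0 ?ler0n // !mulr_ge0.
lra.
Qed.

(** The later bounds are linear in [K], and [1 <= K] lets them absorb the terms free of [K]. *)
Definition perturb_const {R : realType} (K : R) : Prop :=
  1 <= K /\ forall (x d B : R) (n : nat),
    (forall m, (m <= n)%N -> normc (iweyl x m) <= B) ->
    n%:R ^+ 2 * `|d| <= 1 ->
    normc (iweyl (x + d) n - iweyl x n) <= K * (n%:R ^+ 2 * `|d|) * B.

Lemma perturb_const_exists {R : realType} : exists K : R, perturb_const K.
Proof.
by exists 312; split; [rewrite ler1n|exact: iweyl_perturb].
Qed.

(** * Bounds along a convergent *)

(** The bound at the rational point increases with [n], so its value at [n] serves for all
    [m <= n]. *)
Lemma iweyl_near {R : realType} (K : R) (p q n : nat) (x : R) :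
  perturb_const K -> (0 < q)%N -> coprime p q ->
  n%:R ^+ 2 * `|x - p%:R / q%:R| <= 1 ->
  normc (iweyl x n - iweyl (p%:R / q%:R) n) <=
  K * (n%:R ^+ 2 * `|x - p%:R / q%:R|) *
  (n%:R ^+ 2 / Num.sqrt (2 * q%:R) + 4 * n%:R * Num.sqrt q%:R).
Proof.
move=> [_ HK] q0 pq nx.
rewrite -{1}[x](subrK (p%:R / q%:R)) [_ + p%:R / _]addrC.
apply: HK => // m mn; rewrite (le_trans (iweyl_rational_le m q0 pq)) //.
have mn' : m%:R <= n%:R :> R by rewrite ler_nat.
apply: lerD; last by rewrite ler_wpM2r ?sqrtr_ge0 // ler_wpM2l.
by rewrite ler_wpM2r ?invr_ge0 ?sqrtr_ge0 // lerXn2r ?nnegrE ?ler0n.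
Qed.

Lemma sqrtn_ge1 {R : realType} (q : nat) : (0 < q)%N -> 1 <= Num.sqrt (q%:R : R).
Proof. by move=> q0; rewrite -[leLHS]sqrtr1 ler_sqrt ?ler1n ?ler0n. Qed.

Lemma sqr_sqrtn {R : realType} (q : nat) : Num.sqrt (q%:R : R) ^+ 2 = q%:R.
Proof. by rewrite sqr_sqrtr ?ler0n. Qed.

Lemma inv_sqrt2n_le {R : realType} (q : nat) : (0 < q)%N ->
  (Num.sqrt (2 * q%:R : R))^-1 <= (Num.sqrt q%:R)^-1.
Proof.
move=> q0; have qr : 0 < (q%:R : R) by rewrite ltr0n.
by rewrite lef_pV2 ?posrE ?sqrtr_gt0 ?mulr_gt0 // ler_sqrt ?mulr_gt0 //; lra.
Qed.

Lemma iweyl_rational_short {R : realType} (q n : nat) : (0 < q)%N -> (n <= q)%N ->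
  n%:R ^+ 2 / Num.sqrt (2 * q%:R) + 4 * n%:R * Num.sqrt q%:R
    <= 5 * n%:R * Num.sqrt (q%:R : R).
Proof.
move=> q0 nq; have s1 := @sqrtn_ge1 R q q0.
have nq' : n%:R <= q%:R :> R by rewrite ler_nat.
have : n%:R ^+ 2 / Num.sqrt (2 * q%:R) <= n%:R * Num.sqrt q%:R :> R.
  rewrite (le_trans (ler_wpM2l _ (@inv_sqrt2n_le R q q0))) ?sqr_ge0 //.
  rewrite ler_pdivrMr ?(lt_le_trans ltr01) // -mulrA -expr2 sqr_sqrtn expr2.
  by rewrite ler_wpM2l.
lra.
Qed.

Lemma iweyl_rational_long {R : realType} (q n : nat) : (0 < q)%N -> (q <= n)%N ->
  n%:R * Num.sqrt (q%:R : R) <= n%:R ^+ 2 / Num.sqrt q%:R.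
Proof.
move=> q0 nq; have s1 := @sqrtn_ge1 R q q0.
have nq' : q%:R <= n%:R :> R by rewrite ler_nat.
rewrite ler_pdivlMr ?(lt_le_trans ltr01) // -mulrA -expr2 sqr_sqrtn expr2.
by rewrite ler_wpM2l.
Qed.

(** The perturbation factor is at most [n^2 / q^2], and for [n <= q] the rational bound is at most
    [5 n sqrt q]. The resulting [n^3] cancels the cube in the denominator of the head sum. *)
Lemma iweyl_short_diff {R : realType} (K : R) (p q n : nat) (x : R) :
  perturb_const K -> (0 < q)%N -> coprime p q -> (n <= q)%N ->
  `|x - p%:R / q%:R| <= q%:R ^- 2 ->
  normc (iweyl x n - iweyl (p%:R / q%:R) n) <=
  5 * K * n%:R ^+ 3 * Num.sqrt q%:R / q%:R ^+ 2.
Proof.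
move=> HK q0 pq nq xq; have qr : 0 < (q%:R : R) by rewrite ltr0n.
have nq' : n%:R <= q%:R :> R by rewrite ler_nat.
have K0 : 0 <= K by apply: le_trans ler01 _; case: HK.
have h : n%:R ^+ 2 * `|x - p%:R / q%:R| <= n%:R ^+ 2 / q%:R ^+ 2.
  by rewrite ler_wpM2l ?sqr_ge0.
have h1 : n%:R ^+ 2 / q%:R ^+ 2 <= 1 :> R.
  by rewrite ler_pdivrMr ?exprn_gt0 // mul1r lerXn2r ?nnegrE ?ler0n.
rewrite (le_trans (iweyl_near HK _ _ _)) ?(le_trans h) //.
rewrite (le_trans (ler_pM _ _ (ler_wpM2l K0 h) (iweyl_rational_short q0 nq))) ?mulr_ge0 ?sqr_ge0 //.
rewrite le_eqVlt; apply/orP; left; apply/eqP; field.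
by rewrite gt_eqF.
Qed.

Lemma iweyl_short_le {R : realType} (K : R) (p q n : nat) (x : R) :
  perturb_const K -> (0 < q)%N -> coprime p q -> (n <= q)%N ->
  `|x - p%:R / q%:R| <= q%:R ^- 2 ->
  normc (iweyl x n) <= 10 * K * n%:R * Num.sqrt q%:R.
Proof.
move=> HK q0 pq nq xq; have qr : 0 < (q%:R : R) by rewrite ltr0n.
have nq' : n%:R <= q%:R :> R by rewrite ler_nat.
rewrite (le_trans (normc_leB _ (iweyl (p%:R / q%:R) n))) //.
have h1 := iweyl_short_diff HK q0 pq nq xq.
have h2 := le_trans (iweyl_rational_le n q0 pq) (iweyl_rational_short q0 nq) :
  normc (iweyl (p%:R / q%:R : R) n) <= _.
have h3 : 5 * K * n%:R ^+ 3 * Num.sqrt q%:R / q%:R ^+ 2 <= 5 * K * n%:R * Num.sqrt q%:R :> R.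
  rewrite ler_pdivrMr ?exprn_gt0 //.
  have -> : 5 * K * n%:R ^+ 3 * Num.sqrt q%:R = (5 * K * n%:R * Num.sqrt q%:R) * n%:R ^+ 2 :> R.
    by ring.
  by rewrite ler_wpM2l ?mulr_ge0 ?sqrtr_ge0 ?(le_trans ler01 HK.1) // lerXn2r ?nnegrE ?ler0n.
have h4 : 0 <= n%:R * Num.sqrt q%:R :> R by rewrite mulr_ge0 ?sqrtr_ge0.
have : n%:R * Num.sqrt q%:R <= K * (n%:R * Num.sqrt q%:R).
  by rewrite ler_peMl //; case: HK.
lra.
Qed.

Lemma iweyl_long_le {R : realType} (K : R) (p q q' n : nat) (x : R) :
  perturb_const K -> (0 < q)%N -> coprime p q -> (q <= n)%N -> (n ^ 2 <= q * q')%N ->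
  `|x - p%:R / q%:R| <= (q * q')%:R^-1 ->
  normc (iweyl x n) <= n%:R ^+ 2 / Num.sqrt (2 * q%:R) + 4 * n%:R * Num.sqrt q%:R
    + 5 * K * n%:R ^+ 4 / ((q * q')%:R * Num.sqrt q%:R).
Proof.
move=> HK q0 pq qn nq xq; have qr : 0 < (q%:R : R) by rewrite ltr0n.
have n0 : (0 < n)%N by apply: leq_trans qn.
have qq0 : (0 < q * q')%N by apply: leq_trans nq; rewrite expn_gt0 n0.
have qqr : 0 < ((q * q')%:R : R) by rewrite ltr0n.
have s1 := @sqrtn_ge1 R q q0; have s0 := lt_le_trans ltr01 s1.
have K0 : 0 <= K by apply: le_trans ler01 _; case: HK.
have h : n%:R ^+ 2 * `|x - p%:R / q%:R| <= n%:R ^+ 2 / (q * q')%:R.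
  by rewrite ler_wpM2l ?sqr_ge0.
have h1 : n%:R ^+ 2 / (q * q')%:R <= 1 :> R.
  by rewrite ler_pdivrMr // mul1r -natrX ler_nat.
rewrite (le_trans (normc_leB _ (iweyl (p%:R / q%:R) n))) //.
apply: lerD; first exact: iweyl_rational_le.
rewrite (le_trans (iweyl_near HK _ _ _)) ?(le_trans h) //.
have h2 : n%:R ^+ 2 / Num.sqrt (2 * q%:R) + 4 * n%:R * Num.sqrt q%:R
   <= 5 * (n%:R ^+ 2 / Num.sqrt (q%:R : R)).
  have := @iweyl_rational_long R q n q0 qn.
  have := ler_wpM2l (sqr_ge0 (n%:R : R)) (@inv_sqrt2n_le R q q0).
  lra.
rewrite (le_trans (ler_pM _ _ (ler_wpM2l K0 h) h2)) ?mulr_ge0 ?sqr_ge0 //.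
rewrite le_eqVlt; apply/orP; left; apply/eqP; field.
by rewrite !gt_eqF // ltr0n; case: (q') qq0 => //; rewrite muln0.
Qed.

(** Induction through [ln (1 - 1/b) <= - 1/b]. The numerator is the last index [b.-1], because
    [long_sum_le] controls only its square. *)
Lemma sum_inv_le {R : realType} (a b : nat) : (0 < a < b)%N ->
  \sum_(a <= m < b) (m%:R)^-1 <= a%:R^-1 + ln ((b.-1)%:R / a%:R) :> R.
Proof.
case/andP=> a0; have ar : 0 < (a%:R : R) by rewrite ltr0n.
elim: b => // b IH; rewrite ltnS leq_eqVlt => /predU1P[<-|ab].
  by rewrite big_nat1 /= divff ?gt_eqF // ln1 addr0.
rewrite big_nat_recr /=; last exact: ltnW.
have b1 : (0 < b.-1)%N by lia.
have br : 0 < (b%:R : R) by rewrite ltr0n; lia.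
have b1r : 0 < ((b.-1)%:R : R) by rewrite ltr0n.
apply: le_trans (lerD (IH ab) (lexx _)) _.
rewrite !ln_div ?posrE //.
have hb : b.-1%:R = b%:R - 1 :> R.
  by rewrite -[b in RHS](prednK (_ : 0 < b)%N) ?ltn_predL; [rewrite -natr1 addrK|lia].
have h : 1 + - b%:R^-1 = b.-1%:R / b%:R :> R by rewrite hb mulrBl divff ?gt_eqF //; ring.
have h2 : -1 < - b%:R^-1 :> R by rewrite ltrN2 invf_lt1 // ltr1n; lia.
have := le_ln1Dx h2; rewrite h ln_div ?posrE //; lra.
Qed.

Lemma sum_inv_sqr_le {R : realType} (a b : nat) : (0 < a <= b)%N ->
  \sum_(a <= m < b) (m%:R ^+ 2)^-1 <= 2 / a%:R - 2 / b%:R :> R.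
Proof.
case/andP=> a0; elim: b => [|b IH]; first by rewrite leqn0 => /eqP a0'; rewrite a0' in a0.
rewrite leq_eqVlt => /predU1P[<-|ab]; first by rewrite big_geq // subrr.
rewrite big_nat_recr //= (le_trans (lerD (IH ab) (lexx _))) //.
have b1 : 1 <= (b%:R : R) by rewrite ler1n; lia.
(* Telescoping: [1 / b^2 <= 2 / (b (b + 1))] for [b >= 1]. *)
have -> : 2 / b.+1%:R = 2 / b%:R - 2 / (b%:R * (b%:R + 1)) :> R.
  rewrite -natr1; field; rewrite !gt_eqF //; lra.
have : (b%:R ^+ 2)^-1 <= 2 / (b%:R * (b%:R + 1)) :> R.
  rewrite ler_pdivlMr; last by nra.
  rewrite mulrC ler_pdivrMr; last by nra.
  nra.
lra.
Qed.

Lemma sum_id_le {R : realType} (a b : nat) :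
  \sum_(a <= m < b.+1) m%:R <= b%:R ^+ 2 :> R.
Proof.
have [ab|ab] := leqP a b.+1; last by rewrite big_geq ?sqr_ge0 // ltnW.
rewrite (le_trans (_ : _ <= \sum_(0 <= m < b.+1) m%:R)) //.
  by rewrite [leRHS](@big_cat_nat _ _ _ a) //= lerDr sumr_ge0.
elim: b {ab} => [|b IH]; first by rewrite big_nat1 expr0n.
rewrite big_nat_recr //= (le_trans (lerD IH (lexx _))) // -natr1.
have : 0 <= b%:R :> R by []. 
nra.
Qed.

(** The three parts of [iweyl_long_le] give sums of [1/m], [1/m^2] and [m]. The first has length
    [ln (q'/q) / 2], since [m] stops near [sqrt (q q')]; its coefficient [2 / sqrt (2 q)] then
    yields the logarithm with constant exactly 1. The others contribute [O(1 / sqrt q)]. *)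
Lemma long_sum_le {R : realType} (K : R) (p q q' b : nat) (x : R) :
  perturb_const K -> (0 < q)%N -> coprime p q -> (q < b)%N ->
  (b.-1 ^ 2 <= q * q')%N ->
  `|x - p%:R / q%:R| <= (q * q')%:R^-1 ->
  \sum_(q <= m < b) 2 * normc (iweyl x m) / m%:R ^+ 3 <=
  ln (q'%:R / q%:R) / Num.sqrt (2 * q%:R) + 28 * K / Num.sqrt q%:R.
Proof.
move=> HK q0 pq qb bq xq; have qr : 0 < (q%:R : R) by rewrite ltr0n.
have K1 := HK.1.
have s1 := @sqrtn_ge1 R q q0; have s0 := lt_le_trans ltr01 s1.
have q'0 : (0 < q')%N.
  case: (q') bq => //; rewrite muln0 leqn0 expn_eq0 andbT => /eqP.
  by case: (b) qb => [//|[|//]]; case: (q) q0.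
have q'r : 0 < (q'%:R : R) by rewrite ltr0n.
have r0 : 0 < Num.sqrt (2 * q%:R : R) by rewrite sqrtr_gt0 mulr_gt0.
have rs := @inv_sqrt2n_le R q q0.
set s := Num.sqrt q%:R in s0 s1 rs *; set r := Num.sqrt (2 * q%:R) in r0 rs *.
have ss : s ^+ 2 = q%:R by exact: sqr_sqrtn.
have H m : (q <= m < b)%N -> 2 * normc (iweyl x m) / m%:R ^+ 3 <=
    2 / r * m%:R^-1 + 8 * s * (m%:R ^+ 2)^-1 + 10 * K / ((q * q')%:R * s) * m%:R.
  move=> /andP[qm mb]; have m0 : 0 < (m%:R : R) by rewrite ltr0n; lia.
  have mq : (m ^ 2 <= q * q')%N by rewrite (leq_trans _ bq) // leq_sqr; lia.
  have := iweyl_long_le HK q0 pq qm mq xq.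
  rewrite -/s -/r => h; rewrite ler_pdivrMr ?exprn_gt0 //.
  have -> : (2 / r * m%:R^-1 + 8 * s * (m%:R ^+ 2)^-1 +
      10 * K / ((q * q')%:R * s) * m%:R) * m%:R ^+ 3 =
    2 * (m%:R ^+ 2 / r + 4 * m%:R * s + 5 * K * m%:R ^+ 4 / ((q * q')%:R * s)).
    by field; rewrite !gt_eqF // ltr0n muln_gt0 q0.
  by rewrite ler_pM2l.
rewrite (le_trans (ler_sum_nat H)) // !big_split /= -!mulr_sumr.
have h1 : \sum_(q <= m < b) (m%:R)^-1 <= 1 + ln (q'%:R / q%:R) / 2 :> R.
  apply: le_trans (sum_inv_le _) _; first by rewrite q0.
  apply: lerD; first by rewrite invf_le1 // ler1n.
  have br : 0 < (b.-1%:R : R) by rewrite ltr0n; lia.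
  rewrite ler_pdivlMr // mulr_natr -lnXn ?divr_gt0 // ler_ln ?posrE ?exprn_gt0 ?divr_gt0 //.
  rewrite expr_div_n ler_pdivrMr ?exprn_gt0 //.
  have -> : q'%:R / q%:R * q%:R ^+ 2 = (q * q')%:R :> R.
    by rewrite natrM; field; rewrite gt_eqF.
  by rewrite -natrX ler_nat.
have h2 : \sum_(q <= m < b) (m%:R ^+ 2)^-1 <= 2 / q%:R :> R.
  apply: le_trans (sum_inv_sqr_le _) _; first by rewrite q0 ltnW.
  by rewrite lerBlDr lerDl divr_ge0.
have h3 : \sum_(q <= m < b) m%:R <= (q * q')%:R :> R.
  rewrite -(prednK (_ : 0 < b)%N) ?(leq_ltn_trans _ qb) //.
  by rewrite (le_trans (sum_id_le _ _)) // -natrX ler_nat.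
have g1 : 2 / r * \sum_(q <= m < b) (m%:R)^-1 <= 2 / r * (1 + ln (q'%:R / q%:R) / 2).
  by rewrite ler_wpM2l // divr_ge0 // ltW.
have g2 : 8 * s * \sum_(q <= m < b) (m%:R ^+ 2)^-1 <= 16 / s.
  rewrite (le_trans (ler_wpM2l _ h2)) ?mulr_ge0 ?(ltW s0) //.
  by rewrite le_eqVlt -ss; apply/orP; left; apply/eqP; field; rewrite gt_eqF.
have g3 : 10 * K / ((q * q')%:R * s) * \sum_(q <= m < b) m%:R <= 10 * K / s.
  have qq : 0 < (q * q')%:R :> R by rewrite ltr0n muln_gt0 q0.
  rewrite (le_trans (ler_wpM2l _ h3)) //.
    by rewrite divr_ge0 // mulr_ge0 ?(ltW s0) ?(le_trans ler01 K1).
  rewrite le_eqVlt; apply/orP; left; apply/eqP; field.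
  by rewrite !gt_eqF.
have -> : ln (q'%:R / q%:R) / r = 2 / r * (1 + ln (q'%:R / q%:R) / 2) - 2 / r.
  by field; rewrite gt_eqF.
have g4 : 18 / s <= 18 * K / s by rewrite ler_wpM2r ?invr_ge0 ?(ltW s0) //; lra.
lra.
Qed.

(** Below [q'] the terms are at most [20 K sqrt q' / m^2], with sum at most [40 K sqrt q' / a], and
    [a >= sqrt (q q')]. *)
Lemma short_sum_le {R : realType} (K : R) (p q q' a : nat) (x : R) :
  perturb_const K -> (0 < q <= q')%N -> coprime p q' -> (q * q' <= a ^ 2)%N ->
  `|x - p%:R / q'%:R| <= q'%:R ^- 2 ->
  \sum_(a <= m < q') 2 * normc (iweyl x m) / m%:R ^+ 3 <= 40 * K / Num.sqrt q%:R.
Proof.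
move=> HK /andP[q0 qq'] pq aq xq; have qr : 0 < (q%:R : R) by rewrite ltr0n.
have K1 := HK.1; have q'0 : (0 < q')%N by apply: leq_trans qq'.
have s1 := @sqrtn_ge1 R q q0; have s0 := lt_le_trans ltr01 s1.
have s1' := @sqrtn_ge1 R q' q'0; have s0' := lt_le_trans ltr01 s1'.
have K0 : 0 <= K by apply: le_trans K1.
have [aq'|aq'] := leqP a q'; last first.
  by rewrite big_geq ?(ltnW aq') // divr_ge0 ?sqrtr_ge0 // mulr_ge0.
have a0 : (0 < a)%N by case: (a) aq => //; nia.
have ar : 0 < (a%:R : R) by rewrite ltr0n.
set s := Num.sqrt q%:R in s0 s1 *.
set s' := Num.sqrt q'%:R in s1' s0'.
have H m : (a <= m < q')%N -> 2 * normc (iweyl x m) / m%:R ^+ 3 <=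
    20 * K * s' * (m%:R ^+ 2)^-1.
  move=> /andP[am mb]; have m0 : 0 < (m%:R : R) by rewrite ltr0n; lia.
  have h := iweyl_short_le HK q'0 pq (ltnW mb) xq.
  rewrite ler_pdivrMr ?exprn_gt0 //.
  have -> : 20 * K * s' * (m%:R ^+ 2)^-1 * m%:R ^+ 3 = 2 * (10 * K * m%:R * s').
    by field; rewrite gt_eqF.
  by rewrite ler_pM2l.
rewrite (le_trans (ler_sum_nat H)) // -mulr_sumr.
have h2 : \sum_(a <= m < q') (m%:R ^+ 2)^-1 <= 2 / a%:R :> R.
  apply: le_trans (sum_inv_sqr_le _) _; first by rewrite a0.
  by rewrite lerBlDr lerDl divr_ge0.
rewrite (le_trans (ler_wpM2l _ h2)) ?mulr_ge0 ?(ltW s0') //.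
rewrite mulrA ler_pdivrMr // [leRHS]mulrAC ler_pdivlMr //.
have h3 : s' * s <= a%:R.
  rewrite -sqrtrM ?ler0n // -[leRHS]ger0_norm ?ler0n // -sqrtr_sqr ler_sqrt ?sqr_ge0 //.
  by rewrite -natrM -natrX ler_nat mulnC.
have -> : 20 * K * s' * 2 * s = 40 * K * (s' * s) by ring.
by rewrite ler_wpM2l // mulr_ge0.
Qed.

Lemma block_sum_le {R : realType} (K : R) (p q p' q' : nat) (x : R) :
  perturb_const K -> (0 < q <= q')%N -> coprime p q -> coprime p' q' ->
  `|x - p%:R / q%:R| <= (q * q')%:R^-1 ->
  `|x - p'%:R / q'%:R| <= q'%:R ^- 2 ->
  \sum_(q <= m < q') 2 * normc (iweyl x m) / m%:R ^+ 3 <=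
  ln (q'%:R / q%:R) / Num.sqrt (2 * q%:R) + 68 * K / Num.sqrt q%:R.
Proof.
move=> HK /andP[q0]; rewrite leq_eqVlt => /predU1P[<- _ _ _ _|qq' pq pq' xq xq'].
  rewrite big_geq // divff ?pnatr_eq0 -?lt0n // ln1 mul0r add0r.
  by rewrite divr_ge0 ?sqrtr_ge0 ?mulr_ge0 ?(le_trans ler01 HK.1).
(* The cut [M] is the least integer whose square exceeds [q q']: it lies in [(q, q']], and [M - 1]
   is still in the range of the first convergent. The constants add up to [28 + 40 = 68]. *)
have exM : exists M, (q * q' < M ^ 2)%N by exists (q * q').+1; nia.
case: (ex_minnP exM) => M hM minM.
have qM : (q < M)%N by rewrite -ltn_sqr (leq_ltn_trans _ hM) // -mulnn leq_mul2l ltnW // orbT.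
have Mq' : (M <= q')%N by apply: minM; rewrite -mulnn ltn_mul2r qq' (leq_trans _ qq').
have M1 : (M.-1 ^ 2 <= q * q')%N.
  by rewrite leqNgt; apply/negP => /minM; lia.
rewrite (@big_cat_nat _ _ _ M) ?(ltnW qM) //=.
have h1 := long_sum_le HK q0 pq qM M1 xq.
have h2 := short_sum_le HK (_ : 0 < q <= q')%N pq' (ltnW hM) xq'.
rewrite q0 (ltnW qq') in h2; have {}h2 := h2 isT.
apply: le_trans (lerD h1 h2) _.
by rewrite -addrA lerD2l -mulrDl -mulrDl ler_wpM2r ?invr_ge0 ?sqrtr_ge0 // ler_wpM2r ?(le_trans ler01 HK.1) //; lra.
Qed.

(** By the cubic gain in [iweyl_short_diff] each of the fewer than [q] terms is at most
    [10 K sqrt q / q^2]. *)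
Lemma head_sum_le {R : realType} (K : R) (p q : nat) (x : R) :
  perturb_const K -> (0 < q)%N -> coprime p q ->
  `|x - p%:R / q%:R| <= q%:R ^- 2 ->
  \sum_(1 <= m < q) 2 * normc (iweyl x m - iweyl (p%:R / q%:R) m) / m%:R ^+ 3 <=
  10 * K / Num.sqrt q%:R.
Proof.
move=> HK q0 pq xq; have qr : 0 < (q%:R : R) by rewrite ltr0n.
have s1 := @sqrtn_ge1 R q q0; have s0 := lt_le_trans ltr01 s1.
have K0 : 0 <= K by apply: le_trans HK.1.
set s := Num.sqrt q%:R in s0 s1 *.
have ss : s ^+ 2 = q%:R by exact: sqr_sqrtn.
have H m : (1 <= m < q)%N ->
   2 * normc (iweyl x m - iweyl (p%:R / q%:R) m) / m%:R ^+ 3 <= 10 * K * s / q%:R ^+ 2.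
  move=> /andP[m1 mq]; have m0 : 0 < (m%:R : R) by rewrite ltr0n.
  have h := iweyl_short_diff HK q0 pq (ltnW mq) xq.
  rewrite ler_pdivrMr ?exprn_gt0 //.
  have -> : 10 * K * s / q%:R ^+ 2 * m%:R ^+ 3 = 2 * (5 * K * m%:R ^+ 3 * s / q%:R ^+ 2).
    by field; rewrite gt_eqF.
  by rewrite ler_pM2l.
rewrite (le_trans (ler_sum_nat H)) // big_const_nat iter_addr_0 -[leLHS]mulr_natl.
have -> : 10 * K / s = q%:R * (10 * K * s / q%:R ^+ 2).
  by rewrite -ss; field; rewrite gt_eqF.
by rewrite ler_wpM2r ?ler_nat ?leq_subr // divr_ge0 ?sqr_ge0 ?mulr_ge0 // ltW.
Qed.

(** Serves convergence: along denominators tending to infinity it gives [V_n = o(n^2)]. The two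
    convergents are again used on either side of [n^2 = q q']. *)
Lemma iweyl_decay {R : realType} (K : R) (p q p' q' n : nat) (x : R) :
  perturb_const K -> (0 < q)%N -> coprime p q -> coprime p' q' ->
  `|x - p%:R / q%:R| <= (q * q')%:R^-1 ->
  `|x - p'%:R / q'%:R| <= q'%:R ^- 2 ->
  (q <= n < q')%N ->
  normc (iweyl x n) <= 10 * K * n%:R ^+ 2 / Num.sqrt q%:R.
Proof.
move=> HK q0 pq pq' xq xq' /andP[qn nq']; have qr : 0 < (q%:R : R) by rewrite ltr0n.
have s1 := @sqrtn_ge1 R q q0; have s0 := lt_le_trans ltr01 s1.
have K0 : 0 <= K by apply: le_trans HK.1.
have q'0 : (0 < q')%N by apply: leq_ltn_trans nq'.
have nr : 0 < (n%:R : R) by rewrite ltr0n (leq_trans q0).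
have [nq|nq] := leqP (n ^ 2) (q * q').
  apply: le_trans (iweyl_long_le HK q0 pq qn nq xq) _.
  have h1 := @iweyl_rational_long R q n q0 qn.
  have h2 := ler_wpM2l (sqr_ge0 (n%:R : R)) (@inv_sqrt2n_le R q q0).
  set s := Num.sqrt q%:R in s0 s1 h1 h2 *.
  have qq : 0 < (q * q')%:R :> R by rewrite ltr0n muln_gt0 q0.
  have h3 : 5 * K * n%:R ^+ 4 / ((q * q')%:R * s) <= 5 * K * n%:R ^+ 2 / s.
    rewrite ler_pdivrMr ?mulr_gt0 //.
    have -> : 5 * K * n%:R ^+ 2 / s * ((q * q')%:R * s) =
        5 * K * n%:R ^+ 2 * (q * q')%:R by field; rewrite gt_eqF.
    have -> : 5 * K * n%:R ^+ 4 = 5 * K * n%:R ^+ 2 * n%:R ^+ 2 by ring.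
    by rewrite ler_wpM2l ?mulr_ge0 ?sqr_ge0 // -natrX ler_nat.
  have h4 : n%:R ^+ 2 / s <= K * (n%:R ^+ 2 / s).
    by rewrite ler_peMl ?HK.1 // divr_ge0 ?sqr_ge0 ?ltW.
  lra.
apply: le_trans (iweyl_short_le HK q'0 pq' (ltnW nq') xq') _.
rewrite ler_pdivlMr // -!mulrA ler_wpM2l // ler_wpM2l // expr2 ler_pM2l //.
rewrite -sqrtrM ?ler0n // -[leRHS]ger0_norm ?ler0n // -sqrtr_sqr ler_sqrt ?sqr_ge0 //.
by rewrite -natrM -natrX ler_nat mulnC ltnW.
Qed.

(** * Chains of approximations *)

(** The properties of the convergents from [p/q] on that the estimate relies on. Monotonicity is
    weak, as [q_0 = q_1 = 1] can occur; growth comes from doubling every two steps. *)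
Record approx_chain {R : realType} (x : R) (P Q : nat -> nat) : Prop := ApproxChain {
  chain_gt0 : forall k, (0 < Q k)%N;
  chain_le : forall k, (Q k <= Q k.+1)%N;
  chain_double : forall k, (2 * Q k <= Q k.+2)%N;
  chain_coprime : forall k, coprime (P k) (Q k);
  chain_approx : forall k, `|x - (P k)%:R / (Q k)%:R| <= (Q k * Q k.+1)%:R^-1 }.

Lemma chain_leq {R : realType} (x : R) P Q : approx_chain x P Q ->
  {homo Q : m n / (m <= n)%N}.
Proof. by move=> [_ H _ _ _]; apply: homo_leq => // y x' z; exact: leq_trans. Qed.

Lemma chain_ge {R : realType} (x : R) P Q : approx_chain x P Q ->
  forall n, (n <= Q (2 * n))%N.
Proof.
move=> H; elim=> // n IH; have h0 := chain_gt0 H (2 * n).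
by have := chain_double H (2 * n); rewrite mulnS !addSn add0n; lia.
Qed.

Lemma chain_near {R : realType} (x : R) P Q k : approx_chain x P Q ->
  `|x - (P k)%:R / (Q k)%:R| <= (Q k)%:R ^- 2.
Proof.
move=> H; apply: le_trans (chain_approx H k) _.
have q0 : 0 < (Q k)%:R :> R by rewrite ltr0n (chain_gt0 H).
rewrite lef_pV2 ?posrE ?exprn_gt0 ?ltr0n ?muln_gt0 ?(chain_gt0 H k) ?(chain_gt0 H k.+1) //.
by rewrite -natrX ler_nat -mulnn leq_mul2l (chain_le H) orbT.
Qed.

(** Comparison with a geometric series, peeling off two terms at a time: [7 / sqrt 2 <= 5] and
    [7 = 1 + 1 + 5]. *)
Lemma sum_inv_sqrt_le {R : realType} (Q : nat -> nat) n : (forall k, (0 < Q k)%N) ->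
  (forall k, (Q k <= Q k.+1)%N) -> (forall k, (2 * Q k <= Q k.+2)%N) ->
  \sum_(k < n) (Num.sqrt (Q k)%:R)^-1 <= 7 / Num.sqrt (Q 0%N)%:R :> R.
Proof.
elim/ltn_ind: n Q => -[|[|n]] IH Q Q0 Q1 Q2.
- by rewrite big_ord0 divr_ge0 ?sqrtr_ge0.
- by rewrite big_ord1 ler_peMl ?invr_ge0 ?sqrtr_ge0 // ler1n.
rewrite 2!big_ord_recl.
have := IH n (leqnSn _) (fun k => Q k.+2) (fun k => Q0 _) (fun k => Q1 _) (fun k => Q2 _).
rewrite /= => h.
have s0 : 0 < Num.sqrt (Q 0%N)%:R :> R by rewrite sqrtr_gt0 ltr0n.
have h1 : (Num.sqrt (Q 1%N)%:R)^-1 <= (Num.sqrt (Q 0%N)%:R)^-1 :> R.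
  by rewrite lef_pV2 ?posrE ?sqrtr_gt0 ?ltr0n // ler_sqrt ?ler0n // ler_nat.
have h2 : 7 / Num.sqrt (Q 2)%:R <= 5 / Num.sqrt (Q 0%N)%:R :> R.
  rewrite ler_pdivrMr ?sqrtr_gt0 ?ltr0n // mulrAC ler_pdivlMr //.
  rewrite -(@ler_pXn2r _ 2) ?nnegrE ?mulr_ge0 ?sqrtr_ge0 // !exprMn !sqr_sqrtn.
  have : 2 * (Q 0%N)%:R <= (Q 2)%:R :> R by rewrite -natrM ler_nat.
  have : 0 < (Q 0%N)%:R :> R by rewrite ltr0n.
  lra.
have -> : 7 / Num.sqrt (Q 0%N)%:R = (Num.sqrt (Q 0%N)%:R)^-1 +
   ((Num.sqrt (Q 0%N)%:R)^-1 + 5 / Num.sqrt (Q 0%N)%:R) :> R by ring.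
apply: lerD => //; apply: lerD => //; exact: le_trans h2.
Qed.

Lemma chain_sum_le {R : realType} (K : R) (x : R) P Q n : perturb_const K ->
  approx_chain x P Q ->
  \sum_(Q 0%N <= m < Q n) 2 * normc (iweyl x m) / m%:R ^+ 3 <=
  \sum_(k < n) (ln ((Q k.+1)%:R / (Q k)%:R) / Num.sqrt (2 * (Q k)%:R)
     + 68 * K / Num.sqrt (Q k)%:R).
Proof.
move=> HK H; elim: n => [|n IH]; first by rewrite big_geq ?big_ord0.
rewrite (@big_cat_nat _ _ _ (Q n)) ?(chain_leq H) //= big_ord_recr /= lerD //.
apply: (block_sum_le HK) (chain_coprime H n) (chain_coprime H n.+1) (chain_approx H n) (chain_near n.+1 H).
by rewrite (chain_gt0 H) (chain_le H).
Qed.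

(** Partial sums of [Z]. *)
Definition chain_weight {R : realType} (Q : nat -> nat) (n : nat) : R :=
  \sum_(k < n) Num.sqrt ((Q 0%N)%:R / (Q k)%:R) * ln ((Q k.+1)%:R / (Q k)%:R).

Lemma chain_tail_le {R : realType} (K : R) (x : R) P Q T N : perturb_const K ->
  approx_chain x P Q -> (forall n, chain_weight Q n <= T) ->
  \sum_(Q 0%N <= m < N) 2 * normc (iweyl x m) / m%:R ^+ 3 <=
  T / Num.sqrt (2 * (Q 0%N)%:R) + 476 * K / Num.sqrt (Q 0%N)%:R.
Proof.
move=> HK H HT; have q0 k : 0 < (Q k)%:R :> R by rewrite ltr0n (chain_gt0 H).
(* By doubling, [N <= Q (2 N)], so these blocks cover the whole range. The constant is
   [476 = 7 * 68]. *)
set n := (2 * N)%N.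
rewrite (le_trans (_ : _ <= \sum_(Q 0%N <= m < Q n) 2 * normc (iweyl x m) / m%:R ^+ 3)) //.
  have pos m : 0 <= 2 * normc (iweyl x m) / m%:R ^+ 3.
    by rewrite divr_ge0 ?exprn_ge0 // mulr_ge0 ?normc_ge0.
  have [NQ|NQ] := leqP N (Q 0%N); first by rewrite big_geq // sumr_ge0.
  rewrite [leRHS](@big_cat_nat _ _ _ N) ?(ltnW NQ) ?(chain_ge H) //=.
  by rewrite lerDl sumr_ge0.
apply: le_trans (chain_sum_le n HK H) _; rewrite big_split /=; apply: lerD.
  have -> : \sum_(k < n) ln ((Q k.+1)%:R / (Q k)%:R) / Num.sqrt (2 * (Q k)%:R) =
     chain_weight Q n / Num.sqrt (2 * (Q 0%N)%:R) :> R.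
    rewrite /chain_weight mulr_suml; apply: eq_bigr => k _.
    rewrite [_ * ln _]mulrC -mulrA; congr (_ * _).
    rewrite !sqrtrM ?sqrtrV ?ler0n //; field.
    by rewrite !gt_eqF ?sqrtr_gt0.
  by rewrite ler_wpM2r ?invr_ge0 ?sqrtr_ge0.
rewrite -mulr_sumr.
rewrite (le_trans (ler_wpM2l _ (sum_inv_sqrt_le _ _ _ _))) //.
- by rewrite mulr_ge0 ?(le_trans ler01 HK.1).
- exact: chain_gt0 H.
- exact: chain_le H.
- exact: chain_double H.
- rewrite mulrA ler_wpM2r ?invr_ge0 ?sqrtr_ge0 //.
  by have := HK.1; lra.
Qed.

Lemma chain_decay {R : realType} (x : R) P Q (eps : R) : approx_chain x P Q ->
  0 < eps -> exists n0, forall n, (n0 <= n)%N -> normc (iweyl x n) <= eps * n%:R ^+ 2.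
Proof.
move=> H e0; have [K HK] := @perturb_const_exists R.
have K1 := HK.1.
(* With [Q k >= N], the bound [10 K / sqrt (Q k)] of [iweyl_decay] is at most [eps]. *)
pose N := (Num.truncn ((10 * K / eps) ^+ 2)).+1.
exists (Q (2 * N)) => n hn.
have [k hk] : exists k, (Q (2 * N) <= Q k)%N /\ (Q k <= n < Q k.+1)%N.
  have ex : exists k, (n < Q k)%N.
    by exists (2 * n.+1)%N; apply: chain_ge H n.+1.
  case: (ex_minnP ex) => -[|k] hk mink.
    by move: hk; rewrite ltnNge (leq_trans (chain_leq H (leq0n (2 * N))) hn).
  exists k; have h1 : (Q k <= n)%N by rewrite leqNgt; apply/negP => /mink; rewrite ltnn.
  split; last by rewrite h1.
  apply: (chain_leq H); rewrite leqNgt; apply/negP => /(chain_leq H) h2.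
  by move: hk; rewrite ltnNge (leq_trans h2 hn).
case: hk => hQ hk.
apply: le_trans (iweyl_decay HK (chain_gt0 H k) (chain_coprime H k)
  (chain_coprime H k.+1) (chain_approx H k) (chain_near k.+1 H) hk) _.
rewrite mulrAC ler_wpM2r ?sqr_ge0 // ler_pdivrMr ?sqrtr_gt0 ?ltr0n ?(chain_gt0 H) //.
rewrite -ler_pdivrMl // [leLHS]mulrC.
rewrite -(@ler_pXn2r _ 2) ?nnegrE ?sqrtr_ge0 ?divr_ge0 ?(ltW e0) ?mulr_ge0 ?(le_trans ler01 K1) //.
rewrite sqr_sqrtn; apply: le_trans (_ : N%:R <= _); first exact/ltW/truncnS_gt.
by rewrite ler_nat (leq_trans (chain_ge H N)).
Qed.

(** The sums [W] move by at most 1 per step, so [V_(n+h) - V_n] is [h W_n] up to [h^2]. *)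
Lemma iweyl_increment {R : realType} (x : R) n h :
  h%:R * normc (weyl x n) <=
  normc (iweyl x (n + h)) + normc (iweyl x n) + h%:R ^+ 2.
Proof.
have h1 k : normc (weyl x (n + k) - weyl x n) <= k%:R.
  elim: k => [|k IH]; first by rewrite addn0 subrr normc0.
  rewrite addnS weylS addrAC (le_trans (le_normcD _ _)) // normc_e -natr1.
  by rewrite lerD2r.
have h2 k : normc (iweyl x (n + k) - iweyl x n - k%:R * weyl x n) <= k%:R ^+ 2.
  elim: k => [|k IH]; first by rewrite addn0 subrr mul0r subrr normc0 expr0n.
  have -> : iweyl x (n + k.+1) - iweyl x n - k.+1%:R * weyl x n =
    (iweyl x (n + k) - iweyl x n - k%:R * weyl x n) + (weyl x (n + k.+1) - weyl x n).
    by rewrite {1}addnS iweylS -addnS -natr1; ring.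
  rewrite (le_trans (le_normcD _ _)) // (le_trans (lerD IH (h1 _))) // -natr1.
  have : 0 <= k%:R :> R by [].
  nra.
rewrite -{1}(@normc_nat R h) -normcM.
have -> : h%:R * weyl x n = iweyl x (n + h) - iweyl x n
   - (iweyl x (n + h) - iweyl x n - h%:R * weyl x n) by ring.
rewrite (le_trans (le_normcD _ _)) // normcN lerD ?h2 //.
by rewrite (le_trans (le_normcD _ _)) // normcN.
Qed.

(** A Tauberian step: smallness of [V] is differenced over a window of length about [t n]. *)
Lemma weyl_decay {R : realType} (x : R) (eps : R) :
  (forall t : R, 0 < t -> exists n0, forall n, (n0 <= n)%N ->
     normc (iweyl x n) <= t * n%:R ^+ 2) -> 0 < eps ->
  exists n0, forall n, (n0 <= n)%N -> normc (weyl x n) <= eps * n%:R.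
Proof.
(* With [|V_m| <= t^2 m^2] and [t n <= h <= 2 t n], the increment bound divided by [h] is at most
   [10 t n + 2 t n]; [t <= 1] ensures [n + h <= 3 n]. *)
move=> H e0; pose t := Num.min 1 (eps / 12).
have t0 : 0 < t by rewrite lt_min ltr01 divr_gt0.
have t1 : t <= 1 by rewrite ge_min lexx.
have te : 12 * t <= eps by rewrite mulrC -ler_pdivlMr // ge_min lexx orbT.
have [n0 Hn0] := H _ (exprn_gt0 2 t0).
exists (maxn n0 (Num.truncn t^-1).+1) => n; rewrite geq_max => /andP[nn0 nt].
have tn : 1 <= t * n%:R.
  rewrite -ler_pdivrMl // mulr1.
  by apply: le_trans (ltW (truncnS_gt _)) _; rewrite ler_nat.
pose h := (Num.truncn (t * n%:R)).+1.
have h1 : t * n%:R <= h%:R by exact/ltW/truncnS_gt.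
have h2 : h%:R <= 2 * (t * n%:R).
  have h0 : (Num.truncn (t * n%:R))%:R <= t * n%:R.
    by rewrite truncn_le (le_trans ler01 tn).
  rewrite -[h%:R]natr1; lra.
have n_ge0 : 0 <= n%:R :> R by [].
have h3 : h%:R <= 2 * n%:R :> R by nra.
have H1 := iweyl_increment x n h.
have H2 := Hn0 n nn0.
have H3 : normc (iweyl x (n + h)) <= t ^+ 2 * (3 * n%:R) ^+ 2.
  rewrite (le_trans (Hn0 _ (leq_trans nn0 (leq_addr _ _)))) // ler_wpM2l ?sqr_ge0 //.
  by rewrite lerXn2r ?nnegrE ?mulr_ge0 // natrD; lra.
have H4 : h%:R ^+ 2 <= 2 * (t * n%:R) * h%:R by rewrite expr2 ler_wpM2r.
have H5 : 10 * (t * n%:R) ^+ 2 <= 10 * (t * n%:R) * h%:R.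
  by rewrite expr2 mulrA ler_wpM2l ?mulr_ge0 ?(ltW t0).
have hp : 0 < (h%:R : R) by rewrite ltr0n.
rewrite -(ler_pM2l hp) (le_trans H1) //.
have H6 : h%:R * (12 * t * n%:R) <= h%:R * (eps * n%:R).
  by rewrite ler_wpM2l ?ler0n // ler_wpM2r.
lra.
Qed.

(** * Convergence and size of the series *)

Lemma cvgc_normP {R : realType} (u : nat -> R[i]) (L : R[i]) :
  (forall eps : R, 0 < eps -> exists n0, forall n, (n0 <= n)%N ->
    normc (L - u n) <= eps) ->
  (u : nat -> R[i]^o) @ \oo --> (L : R[i]^o).
Proof.
move=> H; apply/cvgrPdist_le => eps e0.
(* In the order of [R[i]] a positive element has zero imaginary part. *)
case: eps e0 => er ei; rewrite ltcE /= => /andP[/eqP -> e0].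
have [n0 Hn0] := H _ e0.
exists n0 => // n /= nn; rewrite -[`|_|]/((normc (L - u n))%:C) lecR; exact: Hn0.
Qed.

Definition fseries {R : realType} (x : R) (n : nat) : R[i] :=
  \sum_(1 <= m < n.+1) e ((m ^ 2)%:R * x) / m%:R.

Definition smooth_term {R : realType} (x : R) (m : nat) : R[i] :=
  2 * iweyl x m / (m * m.+1 * m.+2)%:R.

(** Two summations by parts, with the boundary terms kept. At [n = 0] the quotient with denominator
    zero vanishes because [iweyl x 0 = 0]. *)
Lemma fseries_smooth {R : realType} (x : R) n :
  fseries x n.+1 = weyl x n.+1 / n.+1%:R + iweyl x n / (n * n.+1)%:R
    + \sum_(1 <= m < n) smooth_term x m.
Proof.
elim: n => [|n IH].
  by rewrite /fseries /weyl !big_nat1 big_geq // iweyl0 mul0r !addr0.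
have -> : fseries x n.+2 = fseries x n.+1 + e ((n.+2 ^ 2)%:R * x) / n.+2%:R.
  by rewrite /fseries big_nat_recr.
rewrite IH [weyl x n.+2]weylS iweylS.
case: n {IH} => [|n].
  rewrite !big_geq // !iweyl0 mul0n mul0r !addr0 add0r.
  by rewrite mul1n; field.
rewrite [in RHS]big_nat_recr //= /smooth_term !natrM -[n.+3%:R]natr1 -[n.+2%:R]natr1 -[n.+1%:R]natr1.
have n0 : (n%:R : R[i]) + 1 != 0 by rewrite natr1 pnatr_eq0.
have n1 : (n%:R : R[i]) + 1 + 1 != 0 by rewrite !natr1 pnatr_eq0.
move: (e _) (weyl _ _) (iweyl _ _) (\sum_(_ <= _ < _) _) => a b c d.
field.
by rewrite n0 n1 -natrD pnatr_eq0.
Qed.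

Lemma smooth_term_le {R : realType} (x : R) m :
  normc (smooth_term x m) <= 2 * normc (iweyl x m) / m%:R ^+ 3.
Proof.
rewrite /smooth_term !normcM normcV !normc_nat.
case: m => [|m]; first by rewrite !mul0n iweyl0 normc0 mulr0 !mul0r.
rewrite ler_wpM2l ?mulr_ge0 ?normc_ge0 //.
rewrite lef_pV2 ?posrE ?exprn_gt0 ?ltr0n // -natrX ler_nat !expnS expn0 muln1 -mulnA.
by apply: leq_mul => //; apply: leq_mul; lia.
Qed.

Lemma summable_complex {R : realType} (u : nat -> R[i]) (v : nat -> R) (B : R) :
  (forall m, normc (u m) <= v m) ->
  (forall n, \sum_(0 <= m < n) v m <= B) ->
  exists L, forall eps : R, 0 < eps -> exists n0, forall n, (n0 <= n)%N ->
    normc (L - \sum_(0 <= m < n) u m) <= eps.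
Proof.
move=> uv vB.
have part (g : R[i] -> R) : (forall z, `|g z| <= normc z) ->
   cvgn (series (fun m => g (u m))).
  move=> gz; apply: normed_cvg.
  apply: nondecreasing_is_cvgn.
    by apply/nondecreasing_seqP => n /=; rewrite /series /= big_nat_recr //= lerDl.
  exists B => _ [n _ <-] /=; rewrite /series /=; apply: le_trans (vB n).
  by apply: ler_sum => m _; exact: le_trans (gz _) (uv _).
have /cvg_ex[/= a ca] := part _ (@normr_Re_le R); have /cvg_ex[/= b cb] := part _ (@normr_Im_le R).
exists (a +i* b) => eps e0.
have e2 : 0 < eps / 2 by rewrite divr_gt0.
move/cvgrPdist_le/(_ _ e2) : ca => [n1 _ H1].
move/cvgrPdist_le/(_ _ e2) : cb => [n2 _ H2].
exists (maxn n1 n2) => n; rewrite geq_max => /andP[/H1 /= h1 /H2 /= h2].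
have sre : complex.Re (\sum_(0 <= m < n) u m) = \sum_(0 <= m < n) complex.Re (u m).
  by rewrite (big_morph (@complex.Re R) (id1 := 0) (op1 := +%R)) // => -[? ?] [? ?].
have sim : complex.Im (\sum_(0 <= m < n) u m) = \sum_(0 <= m < n) complex.Im (u m).
  by rewrite (big_morph (@complex.Im R) (id1 := 0) (op1 := +%R)) // => -[? ?] [? ?].
rewrite /series /= -sre in h1; rewrite /series /= -sim in h2.
move: (\sum_(0 <= m < n) u m) h1 h2 => [c d] /= h1 h2.
by apply: le_trans (normc_le_ReIm ((a - c) +i* (b - d))) _ => /=; lra.
Qed.

(** The constant around which [F] is first measured: the smoothed series at [p/q], cut at [q]. The
    average is compared with it later. *)
Definition fcenter {R : realType} (p q : nat) : R[i] :=
  \sum_(1 <= m < q) smooth_term (p%:R / q%:R) m.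

(** Cut the smoothed series at [q]: below, [x] is compared with [p/q] by [head_sum_le]; above,
    [chain_tail_le] bounds all terms absolutely. The boundary terms vanish in the limit by the decay
    of [V] and [W], and [486 = 476 + 10]. *)
Lemma F_near_fcenter {R : realType} (K T : R) (x : R) P Q : perturb_const K ->
  approx_chain x P Q -> (forall n, chain_weight Q n <= T) ->
  ((fseries x : nat -> R[i]^o) @ \oo --> (F x : R[i]^o)) /\
  normc (F x - fcenter (P 0%N) (Q 0%N)) <=
    T / Num.sqrt (2 * (Q 0%N)%:R) + 486 * K / Num.sqrt (Q 0%N)%:R.
Proof.
move=> HK H HT.
pose v m : R := 2 * normc (iweyl x m) / m%:R ^+ 3.
have v0 m : 0 <= v m by rewrite /v divr_ge0 ?exprn_ge0 // mulr_ge0 ?normc_ge0.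
set q := Q 0%N; set p := P 0%N.
have q0 : (0 < q)%N := chain_gt0 H 0.
set B1 := T / Num.sqrt (2 * q%:R) + 476 * K / Num.sqrt q%:R.
have hB N : \sum_(q <= m < N) v m <= B1 := chain_tail_le N HK H HT.
have hB2 n : \sum_(0 <= m < n) v m <= \sum_(0 <= m < q) v m + B1.
  have [nq|nq] := leqP n q; last first.
    by rewrite (@big_cat_nat _ _ _ q) ?(ltnW nq) //= lerD2l.
  rewrite (le_trans _ (_ : \sum_(0 <= m < q) v m <= _)) //.
    by rewrite [leRHS](@big_cat_nat _ _ _ n) //= lerDl sumr_ge0.
  by rewrite lerDl (le_trans _ (hB q)) // sumr_ge0.
have [L HL] := summable_complex (fun m => smooth_term_le x m) hB2.
have HL' (eps : R) : 0 < eps -> exists n0, forall n, (n0 <= n)%N ->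
   normc (L - fseries x n) <= eps.
  move=> e0; have e3 : 0 < eps / 3 by rewrite divr_gt0.
  have [n1 Hn1] := chain_decay H e3.
  have [n2 Hn2] := weyl_decay (fun t => chain_decay H) e3.
  have [n3 Hn3] := HL _ e3.
  exists (maxn (maxn n1 n2) (maxn n3 1)).+1 => -[//|n].
  rewrite ltnS !geq_max => /andP[/andP[nn1 nn2] /andP[nn3 n0]].
  rewrite fseries_smooth.
  have S0 : \sum_(0 <= m < n) smooth_term x m = \sum_(1 <= m < n) smooth_term x m.
    by rewrite big_ltn // /smooth_term iweyl0 mulr0 mul0r add0r.
  have h3 := Hn3 _ nn3; rewrite S0 in h3.
  have h1 : normc (iweyl x n / (n * n.+1)%:R) <= eps / 3.
    rewrite normcM normcV normc_nat ler_pdivrMr ?ltr0n ?muln_gt0 ?n0 //.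
    rewrite (le_trans (Hn1 _ nn1)) // ler_wpM2l ?(ltW e3) //.
    by rewrite -natrX ler_nat -mulnn leq_mul2l leqnSn orbT.
  have h2 : normc (weyl x n.+1 / n.+1%:R) <= eps / 3.
    by rewrite normcM normcV normc_nat ler_pdivrMr ?ltr0n // Hn2 // ltnW.
  set A := \sum_(1 <= m < n) _ in h3 *.
  set a := weyl _ _ / _ in h2 *; set b := iweyl _ _ / _ in h1 *.
  have -> : L - (a + b + A) = (L - A) - (a + b) by ring.
  rewrite (le_trans (le_normcD _ _)) // normcN.
  have := le_normcD a b; lra.
have cL : (fseries x : nat -> R[i]^o) @ \oo --> (L : R[i]^o) by exact: cvgc_normP.
have -> : F x = L by exact: (cvg_lim (@norm_hausdorff _ _) cL).
split => //.
rewrite /fcenter.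
have h486 : B1 + 10 * K / Num.sqrt q%:R =
   T / Num.sqrt (2 * q%:R) + 486 * K / Num.sqrt q%:R.
  by rewrite /B1 -addrA -mulrDl -mulrDl; congr (_ + _ * _ / _); lra.
rewrite -h486; apply/ler_addgt0Pr => eps e0.
have [n0 Hn0] := HL _ e0.
pose n := maxn n0 q.
have := Hn0 n (leq_maxl _ _) => h.
have S0 : \sum_(0 <= m < n) smooth_term x m =
  \sum_(1 <= m < q) smooth_term x m + \sum_(q <= m < n) smooth_term x m.
  rewrite (@big_cat_nat _ _ _ q) ?leq_maxr //=; congr (_ + _).
  by rewrite big_ltn // /smooth_term iweyl0 mulr0 mul0r add0r.
rewrite S0 in h.
have h1 : normc (\sum_(q <= m < n) smooth_term x m) <= B1.
  rewrite (le_trans _ (hB n)) // (le_trans (normc_sum _ _ _)) //.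
  by apply: ler_sum => m _; exact: smooth_term_le.
have h2 : normc (\sum_(1 <= m < q) smooth_term x m -
    \sum_(1 <= m < q) smooth_term (p%:R / q%:R) m) <= 10 * K / Num.sqrt q%:R.
  apply: le_trans (head_sum_le HK q0 (chain_coprime H 0) (chain_near 0 H)).
  rewrite -sumrB (le_trans (normc_sum _ _ _)) //; apply: ler_sum => m _.
  rewrite /smooth_term -mulrBl -mulrBr.
  rewrite !normcM normcV !normc_nat.
  case: m => [|m]; first by rewrite !mul0n !iweyl0 subrr normc0 mulr0 !mul0r.
  rewrite ler_wpM2l ?mulr_ge0 ?normc_ge0 //.
  rewrite lef_pV2 ?posrE ?exprn_gt0 ?ltr0n // -natrX ler_nat !expnS expn0 muln1 -mulnA.
  by apply: leq_mul => //; apply: leq_mul; lia.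
set a := \sum_(1 <= m < q) smooth_term x m in h h2 *.
set c := \sum_(1 <= m < q) _ in h2 *.
set d := \sum_(q <= m < n) _ in h h1.
have -> : L - c = (L - (a + d)) + (d + (a - c)) by ring.
rewrite (le_trans (le_normcD _ _)) //.
have := le_normcD d (a - c); lra.
Qed.

(** * Continued fraction nodes *)

(** Two consecutive convergents, the primed one being the earlier. *)
Record node := Node { pnum : nat; qden : nat; pnum' : nat; qden' : nat }.

Definition child (s : node) (c : nat) : node :=
  Node (c * pnum s + pnum' s) (c * qden s + qden' s) (pnum s) (qden s).

(** The last clause says that the determinant is 1 or -1, without subtraction of naturals. *)
Definition valid (s : node) : Prop :=
  [/\ (0 < qden s)%N, (qden' s <= qden s)%N &
   (pnum' s * qden s = (pnum s * qden' s).+1)%N \/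
   (pnum s * qden' s = (pnum' s * qden s).+1)%N].

Lemma valid_child s c : valid s -> (0 < c)%N -> valid (child s c).
Proof.
case: s => p q p' q' [/= q0 qq d] c0; split => /=; [nia|nia|].
by case: d => d; [right|left]; nia.
Qed.

Lemma valid_coprime s : valid s -> coprime (pnum s) (qden s).
Proof.
case: s => p q p' q' [/= q0 qq d]; rewrite /coprime -dvdn1.
have [g1 g2] := (dvdn_gcdl p q, dvdn_gcdr p q).
case: d => d.
  have : (gcdn p q %| p * q' + 1)%N by rewrite addn1 -d dvdn_mull.
  by rewrite dvdn_addr // dvdn_mulr.
have : (gcdn p q %| p' * q + 1)%N by rewrite addn1 -d dvdn_mulr.
by rewrite dvdn_addr // dvdn_mull.
Qed.

Definition sgn {R : realType} (s : node) : R :=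
  (pnum' s)%:R * (qden s)%:R - (pnum s)%:R * (qden' s)%:R.

Lemma sgn_child {R : realType} s c : sgn (child s c) = - sgn s :> R.
Proof. by rewrite /sgn /= !natrD !natrM; ring. Qed.

Lemma sgn_sqr {R : realType} s : valid s -> sgn s * sgn s = 1 :> R.
Proof.
case=> _ _ d; rewrite /sgn -!natrM; by case: d => ->; rewrite -natr1; ring.
Qed.

Lemma normr_sgn {R : realType} s : valid s -> `|sgn s| = 1 :> R.
Proof.
move=> vs; apply/eqP; rewrite -(@eqrXn2 _ 2) // ?expr1n.
by rewrite expr2 -normrM sgn_sqr // normr1.
Qed.

(* The distance from [x] to the convergent [pnum s / qden s], counted positively
   on the side where the numbers with these first partial quotients lie. *)
Definition offset {R : realType} (s : node) (x : R) : R :=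
  sgn s * (x - (pnum s)%:R / (qden s)%:R).

Lemma normr_offset {R : realType} s (x : R) : valid s ->
  `|x - (pnum s)%:R / (qden s)%:R| = `|offset s x|.
Proof. by move=> vs; rewrite normrM normr_sgn // mul1r. Qed.

(** The open interval between the convergent and the mediant [(p + p') / (q + q')]. *)
Definition cyl {R : realType} (s : node) : set R :=
  [set x | 0 < offset s x < ((qden s * (qden s + qden' s))%:R)^-1].

(** Consecutive convergents lie [1 / (q q_1)] apart and on opposite sides, so the two offsets add up
    to this distance. *)
Lemma offset_child {R : realType} s c (x : R) : valid s -> (0 < c)%N ->
  offset (child s c) x = ((qden s * qden (child s c))%:R)^-1 - offset s x.
Proof.
move=> vs c0; rewrite /offset sgn_child /=.
have [q0 _ _] := vs.
have qr : (qden s)%:R != 0 :> R by rewrite pnatr_eq0 -lt0n.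
have qc : (c * qden s + qden' s)%:R != 0 :> R by rewrite pnatr_eq0 -lt0n; nia.
have h := @sgn_sqr R s vs.
have E : (qden s * (c * qden s + qden' s))%:R^-1 =
   sgn s * ((c * pnum s + pnum' s)%:R / (c * qden s + qden' s)%:R - (pnum s)%:R / (qden s)%:R) :> R.
  have -> : (c * pnum s + pnum' s)%:R / (c * qden s + qden' s)%:R - (pnum s)%:R / (qden s)%:R
    = sgn s / (qden s * (c * qden s + qden' s))%:R :> R.
    rewrite /sgn; move: qc; rewrite !natrM !natrD !natrM => qc; field.
    by rewrite qr qc.
  by rewrite mulrA h mul1r.
by rewrite E; ring.
Qed.

(** In the offset of the parent, child [c] occupies the gap between [1 / (q q_(c+1))] and
    [1 / (q q_c)], with [q_c] the denominator of that child: the children tile the parent. *)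
Lemma cyl_child {R : realType} s c (x : R) : valid s -> (0 < c)%N ->
  cyl (child s c) x <->
  ((qden s * (qden (child s c) + qden s))%:R)^-1 < offset s x
    < ((qden s * qden (child s c))%:R)^-1.
Proof.
move=> vs c0; rewrite /cyl /= offset_child //.
have [q0 _ _] := vs; have qr : 0 < (qden s)%:R :> R by rewrite ltr0n.
have qc : 0 < (qden (child s c))%:R :> R by rewrite ltr0n /=; nia.
have E : ((qden s * qden (child s c))%:R)^-1 -
   ((qden (child s c) * (qden (child s c) + qden s))%:R)^-1 =
   ((qden s * (qden (child s c) + qden s))%:R)^-1 :> R.
  move: qc; move: (qden (child s c)) => d dr.
  by rewrite !natrM !natrD; field; rewrite !gt_eqF // addr_gt0.
by rewrite /= in E *; rewrite -E; split => /andP[h1 h2]; apply/andP; split; lra.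
Qed.

Lemma cyl_child_sub {R : realType} s c : valid s -> (0 < c)%N ->
  cyl (child s c) `<=` @cyl R s.
Proof.
move=> vs c0 x /(cyl_child x vs c0) /andP[h1 h2]; rewrite /cyl /=.
have [q0 qq _] := vs; apply/andP; split.
  by apply: le_lt_trans h1; rewrite invr_ge0.
apply: lt_le_trans h2 _; rewrite lef_pV2 ?posrE ?ltr0n ?ler_nat /=; nia.
Qed.

(** All endpoints of cylinders are quotients of naturals; what is removed is countable, hence
    null. *)
Definition not_frac {R : realType} : set R :=
  [set x | forall m n : nat, x <> m%:R / n%:R].

(** The integer part of the complete quotient [y], obtained by solving
    [offset s x = 1 / (q (y q + q'))]. *)
Definition digit {R : realType} (s : node) (x : R) : nat :=
  Num.truncn ((((qden s)%:R * offset s x)^-1 - (qden' s)%:R) / (qden s)%:R).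

Lemma cyl_digit {R : realType} s (x : R) : valid s -> not_frac x -> cyl s x ->
  (0 < digit s x)%N /\ cyl (child s (digit s x)) x.
Proof.
move=> vs ix cx; have [q0 qq _] := vs.
have qr : 0 < (qden s)%:R :> R by rewrite ltr0n.
move: (cx) => /= /andP[z0 z1].
set z := offset s x in z0 z1.
have w1 : (qden s)%:R + (qden' s)%:R < ((qden s)%:R * z)^-1.
  rewrite natrM natrD in z1.
  have dz : 0 < (qden s)%:R * z := mulr_gt0 qr z0.
  have dd : 0 < (qden s)%:R + (qden' s)%:R :> R by rewrite (lt_le_trans qr) // lerDl.
  rewrite -[ltLHS]invrK ltf_pV2 ?posrE ?invr_gt0 //.
  rewrite mulrC -ltr_pdivlMr //; apply: lt_le_trans z1 _.
  by rewrite invfM mulrC.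
pose y := (((qden s)%:R * z)^-1 - (qden' s)%:R) / (qden s)%:R.
have y1 : 1 < y by rewrite /y ltr_pdivlMr // mul1r; lra.
have d0 : (0 < digit s x)%N.
  by rewrite /digit -/z -/y truncn_gt_nat ltW.
split => //; apply/cyl_child => //=; rewrite -/z.
have yd : (digit s x)%:R <= y by rewrite /digit -/z -/y truncn_le (le_trans ler01 (ltW y1)).
have yd' : y < (digit s x)%:R + 1 by rewrite natr1 /digit -/z -/y truncnS_gt.
have wy : ((qden s)%:R * z)^-1 = y * (qden s)%:R + (qden' s)%:R.
  by rewrite /y divfK ?gt_eqF // subrK.
have zy : z = ((qden s)%:R * (y * (qden s)%:R + (qden' s)%:R))^-1.
  by rewrite -wy invfM invrK mulrA mulVf ?mul1r // gt_eqF.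
(* An integral [y] would put [x] at the convergent of the child, a fraction. So [y] lies strictly
   between consecutive integers, as the open cylinder demands. *)
have yne : y != (digit s x)%:R.
  apply/eqP => yE; rewrite yE in zy.
  have h := @offset_child R s (digit s x) x vs d0.
  have : offset (child s (digit s x)) x = 0.
    by rewrite h -/z zy /= !natrM !natrD natrM subrr.
  move=> /eqP; rewrite /offset mulf_eq0 => /orP[].
    have := @sgn_sqr R _ (valid_child vs d0).
    by move=> + /eqP e0; rewrite e0 mul0r => /eqP; rewrite eq_sym oner_eq0.
  by rewrite subr_eq0 => /eqP; exact: ix.
have yd2 : (digit s x)%:R < y by rewrite lt_neqAle eq_sym yne.
have dr : 0 < (digit s x)%:R :> R by rewrite ltr0n.
have q'r : 0 <= (qden' s)%:R :> R by [].
rewrite zy !natrM !natrD natrM; apply/andP; split.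
  rewrite ltf_pV2 ?posrE ?mulr_gt0 ?ltr_pM2l //; nra.
rewrite ltf_pV2 ?posrE ?mulr_gt0 ?ltr_pM2l //; nra.
Qed.

Fixpoint traj {R : realType} (s : node) (x : R) (n : nat) : node :=
  if n is n'.+1 then traj (child s (digit s x)) x n' else s.

Lemma trajP {R : realType} s (x : R) n : valid s -> not_frac x -> cyl s x ->
  [/\ valid (traj s x n), cyl (traj s x n) x, (0 < digit (traj s x n) x)%N &
   traj s x n.+1 = child (traj s x n) (digit (traj s x n) x)].
Proof.
elim: n s => [|n IH] s vs ix cx /=.
  by have [d0 _] := cyl_digit vs ix cx.
have [d0 c0] := cyl_digit vs ix cx.
by apply: IH => //; apply: valid_child.
Qed.

(** Doubling is [q_(k+2) >= q_(k+1) + q_k >= 2 q_k]; the approximation bound is the upper end of the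
    child's interval in [cyl_child]. *)
Lemma traj_chain {R : realType} s (x : R) : valid s -> not_frac x -> cyl s x ->
  approx_chain x (fun k => pnum (traj s x k)) (fun k => qden (traj s x k)).
Proof.
move=> vs ix cx; split=> k; have [vk ck dk ek] := trajP k vs ix cx.
- by case: vk.
- by rewrite ek /= (leq_trans _ (leq_addr _ _)) // leq_pmull.
- have [vk' ck' dk' ek'] := trajP k.+1 vs ix cx.
  rewrite ek' ek /= mul2n -addnn leq_add2r.
  rewrite ek in dk'; rewrite (leq_trans _ (leq_pmull _ dk')) //.
  by rewrite (leq_trans _ (leq_addr _ _)) // leq_pmull.
- exact: valid_coprime.
- have [_ ck' _ _] := trajP k.+1 vs ix cx.
  rewrite ek in ck' *; rewrite normr_offset //.
  move: ck => /= /andP[z0 _]; rewrite gtr0_norm //.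
  by move/(cyl_child x vk dk) : ck' => /andP[_ /ltW].
Qed.

(** * Measure of the exceptional sets *)

Lemma offset_itv {R : realType} s (r : R) : valid s -> 0 <= r ->
  exists2 ab : R * R, [set x | 0 < offset s x < r] = `]ab.1, ab.2[%classic &
    ab.2 - ab.1 = r.
Proof.
move=> vs r0; set c : R := (pnum s)%:R / (qden s)%:R.
have : (sgn s : R) = 1 \/ (sgn s : R) = -1.
  have := @sgn_sqr R s vs => /eqP.
  by rewrite -expr2 sqrf_eq1 => /orP[/eqP|/eqP]; [left|right].
case=> hs.
  exists (c, c + r) => /=; last by rewrite addrAC subrr add0r.
  by apply/seteqP; split => x /=; rewrite in_itv /= /offset hs -/c mul1r => /andP[h1 h2];
    apply/andP; split; lra.
exists (c - r, c) => /=; last by rewrite opprB addrC subrK.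
by apply/seteqP; split => x /=; rewrite in_itv /= /offset hs -/c mulN1r => /andP[h1 h2];
    apply/andP; split; lra.
Qed.

Lemma measurable_offset {R : realType} s (r : R) : valid s -> 0 <= r ->
  measurable ([set x | 0 < offset s x < r] : set R).
Proof. by move=> vs r0; have [ab -> _] := offset_itv vs r0; exact: measurable_itv. Qed.

Lemma lebesgue_offset {R : realType} s (r : R) : valid s -> 0 <= r ->
  lebesgue_measure ([set x | 0 < offset s x < r] : set R) = r%:E.
Proof.
move=> vs r0; have [[a b] -> /= ab] := offset_itv vs r0.
rewrite lebesgue_measure_itv /= lte_fin.
case: ltP => h; first by rewrite -EFinD ab.
by congr (_%:E); lra.
Qed.

Definition cyl_len {R : realType} (s : node) : R := ((qden s * (qden s + qden' s))%:R)^-1.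

Lemma cyl_len_ge0 {R : realType} s : 0 <= cyl_len s :> R.
Proof. by rewrite invr_ge0. Qed.

Lemma cyl_len_gt0 {R : realType} s : valid s -> 0 < cyl_len s :> R.
Proof. by case=> q0 _ _; rewrite invr_gt0 ltr0n muln_gt0 q0 ltn_addr. Qed.

Lemma measurable_cyl {R : realType} s : valid s -> measurable (@cyl R s).
Proof. by move=> vs; apply: measurable_offset => //; exact: cyl_len_ge0. Qed.

Lemma lebesgue_cyl {R : realType} s : valid s ->
  lebesgue_measure (@cyl R s) = (cyl_len s)%:E.
Proof. by move=> vs; apply: lebesgue_offset => //; exact: cyl_len_ge0. Qed.

Definition dratio {R : realType} (s : node) (c : nat) : R :=
  (qden (child s c))%:R / (qden s)%:R.

(* The points of [cyl s] along whose trajectory [chain_weight] exceeds [t] within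
   [n] steps: one step with dratio [b = q_1 / q_0] turns the condition
   [ln b + b^(-1/2) * z > t] into [z > (t - ln b) * sqrt b]. *)
Fixpoint bad {R : realType} (n : nat) (s : node) (t : R) : set R :=
  if t < 0 then cyl s else
  if n is n'.+1 then
    \bigcup_(c in [set c | (0 < c)%N])
      bad n' (child s c) ((t - ln (dratio s c)) * Num.sqrt (dratio s c))
  else set0.

Lemma bad_sub_cyl {R : realType} n s (t : R) : valid s -> bad n s t `<=` cyl s.
Proof.
elim: n s t => [|n IH] s t vs /=; case: ifP => _.
- exact: subset_refl.
- exact: sub0set.
- exact: subset_refl.
- move=> x [c /= c0 /IH h].
  by apply: (cyl_child_sub vs c0); apply: h; exact: valid_child.
Qed.

Lemma measurable_bad {R : realType} n s (t : R) : valid s -> measurable (bad n s t).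
Proof.
elim: n s t => [|n IH] s t vs /=; case: ifP => // _; try exact: measurable_cyl.
by apply: bigcup_measurable => c c0; apply: IH; exact: valid_child.
Qed.

Lemma badS {R : realType} n s (t : R) : valid s -> bad n s t `<=` bad n.+1 s t.
Proof.
elim: n s t => [|n IH] s t vs.
  by rewrite /=; case: ifP => _; [exact: subset_refl|exact: sub0set].
rewrite [bad n.+1 s t]/= [bad n.+2 s t]/=; case: ifP => _; first exact: subset_refl.
by move=> x [c /= c0 h]; exists c => //; apply: (IH (child s c)) => //; exact: valid_child.
Qed.

Lemma dratio_ge1 {R : realType} s c : valid s -> (0 < c)%N -> c%:R <= dratio s c :> R.
Proof.
move=> [q0 _ _] c0; rewrite /dratio ler_pdivlMr ?ltr0n //= -natrM ler_nat; exact: leq_addr.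
Qed.

Lemma dratio_le {R : realType} s c : valid s -> dratio s c <= c%:R + 1 :> R.
Proof.
move=> [q0 qq _]; rewrite /dratio ler_pdivrMr ?ltr0n //= natr1 -natrM ler_nat.
by rewrite mulSn addnC leq_add2r.
Qed.

(** Unfolds [Z = ln b + b^(-1/2) Z'] along the trajectory; factors match through [sqrt (q_0 / q_k) *
    sqrt (q_1 / q_0) = sqrt (q_1 / q_k)]. *)
Lemma not_bad {R : realType} n s (x t : R) : valid s -> not_frac x -> cyl s x ->
  ~ bad n s t x -> chain_weight (fun k => qden (traj s x k)) n <= t.
Proof.
elim: n s t => [|n IH] s t vs ix cx /=.
  by rewrite /chain_weight big_ord0; case: ltP => // t0 /(_ cx).
case: ltP => [_ /(_ cx)//|t0 nb].
have [d0 cd] := cyl_digit vs ix cx.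
have vd := valid_child vs d0.
have {}IH := IH _ ((t - ln (dratio s (digit s x))) * Num.sqrt (dratio s (digit s x))) vd ix cd.
have h : chain_weight (fun k => qden (traj s x k.+1)) n <=
   (t - ln (dratio s (digit s x))) * Num.sqrt (dratio s (digit s x)).
  apply: IH => hb; apply: nb; exists (digit s x) => //.
have q0 : 0 < (qden s)%:R :> R by case: vs => q0 _ _; rewrite ltr0n.
set b := dratio s (digit s x) in h.
have b1 : 1 <= b by rewrite (le_trans _ (dratio_ge1 vs d0)) // ler1n.
have b0 := lt_le_trans ltr01 b1.
have sb : 0 < Num.sqrt b by rewrite sqrtr_gt0.
rewrite /chain_weight big_ord_recl /= divff ?gt_eqF // sqrtr1 mul1r.
rewrite -/(dratio s (digit s x)) -/b -lerBrDl -(ler_pM2r sb).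
apply: le_trans h; rewrite /chain_weight mulr_suml ler_sum // => k _.
rewrite le_eqVlt; apply/orP; left; apply/eqP.
rewrite mulrAC; congr (_ * _).
rewrite -sqrtrM ?divr_ge0 //; congr Num.sqrt.
rewrite /b /dratio /bump /=; field.
have [vk _ _ _] := trajP k vd ix cd.
by rewrite !gt_eqF // ltr0n; case: vk.
Qed.

(** Allows [sqrt b] to be replaced by the simple lower bounds 1, 7/5 and 2, for the digit 1, the
    digits 2 and 3, and the larger ones. *)
Lemma expR_weight_le {R : realType} (t b k : R) : 1 <= b -> b <= expR t ->
  k <= Num.sqrt b ->
  expR (- ((t - ln b) * Num.sqrt b)) <= expR (- ((t - ln b) * k)).
Proof.
move=> b1 bt kb; rewrite ler_expR lerN2 ler_wpM2l //.
by rewrite subr_ge0 -[leRHS]expRK ler_ln ?posrE ?expR_gt0 // (lt_le_trans ltr01).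
Qed.

Lemma expR_weight1 {R : realType} (t b : R) : 1 <= b ->
  expR (- ((t - ln b) * 1)) = b * expR (- t).
Proof.
move=> b1; rewrite mulr1 opprB expRD lnK // posrE; exact: lt_le_trans b1.
Qed.

Lemma expR_weight2 {R : realType} (t b : R) : 1 <= b ->
  expR (- ((t - ln b) * 2)) = (b * expR (- t)) ^+ 2.
Proof.
move=> b1; rewrite -expR_weight1 // expr2 -expRD; congr expR; ring.
Qed.

(** The surplus [2/5] of the exponent over 1 gains [expR ((t - ln b) * 2/5)]. With [t >= 1000] and
    [ln b <= 3], the bound [1 + x <= expR x] already makes this at least 200. *)
Lemma expR_weight_small {R : realType} (t b : R) : 1000 <= t -> 1 <= b -> b <= 4 ->
  expR (- ((t - ln b) * (7 / 5))) <= b * expR (- t) / 200.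
Proof.
move=> t1 b1 b4; have b0 : 0 < b by apply: lt_le_trans b1.
have -> : - ((t - ln b) * (7 / 5)) = - ((t - ln b) * 1) - (t - ln b) * (2 / 5) by lra.
rewrite expRD expR_weight1 // ler_wpM2l ?mulr_ge0 ?expR_ge0 ?(ltW b0) //.
rewrite [expR (- (_ * (2 / 5)))]expRN lef_pV2 ?posrE ?expR_gt0 //.
apply: le_trans (expR_ge1Dx _).
have : ln b <= b - 1 by rewrite -[in leLHS](subrK 1 b) addrC le_ln1Dx //; lra.
lra.
Qed.

Lemma cyl_len_child {R : realType} s c : valid s -> (0 < c)%N ->
  cyl_len (child s c) =
  ((qden s)%:R ^+ 2)^-1 * (dratio s c * (dratio s c + 1))^-1 :> R.
Proof.
move=> [q0 _ _] c0; rewrite /cyl_len /dratio.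
have qc : (0 < qden (child s c))%N by rewrite /=; nia.
rewrite [qden' (child s c)]/=.
have qr : 0 < (qden s)%:R :> R by rewrite ltr0n.
have qcr : 0 < (qden (child s c))%:R :> R by rewrite ltr0n.
move: qcr; move: (qden (child s c)) => d dr.
rewrite natrM natrD; field.
by rewrite !gt_eqF // addr_gt0.
Qed.

Lemma child_weight_le {R : realType} s c (t : R) : valid s -> (0 < c)%N ->
  1000 <= t -> dratio s c <= expR t ->
  expR (- ((t - ln (dratio s c)) * Num.sqrt (dratio s c))) *
     (dratio s c * (dratio s c + 1))^-1
  <= if c == 1%N then expR (- t) / (dratio s 1%N + 1)
     else if (c < 4)%N then expR (- t) / 600 else expR (- t) ^+ 2.
Proof.
move=> vs c0 t1 bt; have cb := @dratio_ge1 R s c vs c0.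
have bc := @dratio_le R s c vs.
have b1 : 1 <= dratio s c :> R by apply: le_trans cb; rewrite ler1n.
have E0 := expR_gt0 (- t).
have sq (k : R) : 0 <= k -> k ^+ 2 <= dratio s c -> k <= Num.sqrt (dratio s c).
  by move=> k0 kb; rewrite -[leLHS]ger0_norm // -sqrtr_sqr ler_sqrt // (le_trans ler01 b1).
case: eqP => [c1|c1].
  rewrite -c1; set b := dratio s c in bt cb bc b1 sq *.
  have b0 : 0 < b by apply: lt_le_trans b1.
  have := expR_weight_le b1 bt (sq 1 ler01 _); rewrite expr1n => /(_ b1) h.
  rewrite expR_weight1 // in h.
  rewrite ler_pdivrMr; last by rewrite mulr_gt0 // addr_gt0.
  apply: le_trans h _; rewrite le_eqVlt; apply/orP; left; apply/eqP; field.
  by rewrite gt_eqF // addr_gt0.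
have c2 : 2 <= c%:R :> R by rewrite (ler_nat R 2) ltn_neqAle eq_sym c0 andbT; exact/eqP.
case: ifP => c4.
  have c3 : c%:R <= 3 :> R by rewrite (ler_nat R _ 3) -ltnS.
  set b := dratio s c in bt cb bc b1 sq *.
  have b0 : 0 < b by apply: lt_le_trans b1.
  have h := expR_weight_le b1 bt (sq (7 / 5) _ _).
  have {}h := h ltac:(lra) ltac:(lra).
  have h2 := @expR_weight_small R t b t1 b1 ltac:(lra).
  rewrite ler_pdivrMr; last by rewrite mulr_gt0 // addr_gt0.
  apply: le_trans h _; apply: le_trans h2 _.
  have : 3 * (b * expR (- t)) <= (b + 1) * (b * expR (- t)).
    by rewrite ler_wpM2r ?mulr_ge0 ?(ltW b0) ?(ltW E0) //; lra.
  lra.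
have c5 : 4 <= c%:R :> R by rewrite (ler_nat R 4) leqNgt c4.
set b := dratio s c in bt cb bc b1 sq *.
have b0 : 0 < b by apply: lt_le_trans b1.
have h := expR_weight_le b1 bt (sq 2 _ _).
have {}h := h ltac:(lra) ltac:(lra).
rewrite expR_weight2 // in h.
rewrite ler_pdivrMr; last by rewrite mulr_gt0 // addr_gt0.
apply: le_trans h _; rewrite exprMn mulrC ler_wpM2l ?sqr_ge0 //.
by rewrite expr2 ler_wpM2l ?(ltW b0) //; lra.
Qed.

(** The induction step for the measure bound. Digits from [M], about [e^t / 36], are covered by one
    interval of length at most [36 e^(-t) / q^2], a cost free of [C]. The digit 1 takes
    [1 / (2 + r)] out of the available [1 / (1 + r)], where [r = q'/q]; all other costs fit into the
    difference. *)
Lemma cyl_len_sum_le {R : realType} s (t C : R) (M : nat) : valid s ->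
  1000 <= t -> 1001 <= C -> M = (Num.truncn (expR t / 36)).+1 ->
  \sum_(1 <= c < M) C * expR (- ((t - ln (dratio s c)) * Num.sqrt (dratio s c)))
       * cyl_len (child s c)
  + ((qden s * qden (child s M))%:R)^-1 <= C * expR (- t) * cyl_len s.
Proof.
move=> vs t1 C1 eM; have [q0 qq _] := vs.
have qr : 0 < (qden s)%:R :> R by rewrite ltr0n.
have et : 1001 <= expR t by apply: le_trans (expR_ge1Dx t); lra.
have E0 := expR_gt0 (- t).
have EE : expR t * expR (- t) = 1 by rewrite -expRD subrr expR0.
have M1 : M%:R <= expR t / 36 + 1.
  by rewrite eM -natr1 lerD2r truncn_le divr_ge0 ?expR_ge0.
have M2 : expR t / 36 < M%:R by rewrite eM truncnS_gt.
have M4 : (4 < M)%N by rewrite -(ltr_nat R); apply: le_lt_trans M2; lra.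
(* Below the cut [t - ln b] is nonnegative, as [child_weight_le] requires. *)
have bt c : (c < M)%N -> dratio s c <= expR t.
  move=> cM; apply: le_trans (dratio_le c vs) _.
  have : c%:R + 1 <= M%:R :> R by rewrite natr1 ler_nat.
  lra.
pose E := expR (- t).
have E1 : E <= 1 / 1001.
  have : 1001 * E <= expR t * E by rewrite ler_wpM2r ?(ltW E0).
  rewrite EE; lra.
have S : \sum_(1 <= c < M) expR (- ((t - ln (dratio s c)) * Num.sqrt (dratio s c))) *
     (dratio s c * (dratio s c + 1))^-1 <=
   E / (dratio s 1%N + 1) + E / 300 + E * (1 / 36 + E).
  rewrite (le_trans (_ : _ <= \sum_(1 <= c < M) (if c == 1%N then E / (dratio s 1%N + 1)
     else if (c < 4)%N then E / 600 else E ^+ 2))) //.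
    rewrite big_nat_cond [leRHS]big_nat_cond; apply: ler_sum => c /andP[/andP[c1 cM] _].
    by apply: child_weight_le => //; apply: bt.
  rewrite big_ltn ?(leq_trans _ M4) // big_ltn ?(leq_trans _ M4) //.
  rewrite big_ltn ?(leq_trans _ M4) //.
  rewrite /=.
  have -> : \sum_(4 <= i < M) (if i == 1%N then E / (dratio s 1%N + 1)
     else if (i < 4)%N then E / 600 else E ^+ 2) = \sum_(4 <= i < M) E ^+ 2.
    rewrite big_nat_cond [RHS]big_nat_cond; apply: eq_bigr => c /andP[/andP[c4 cM] _].
    by rewrite (gtn_eqF (leq_trans (isT : (1 < 4)%N) c4)) ltnNge c4.
  rewrite big_const_nat iter_addr_0 -[X in _ + (_ + (_ + X))]mulr_natl.
  (* Fewer than [M <= e^t / 36 + 1] digits cost [E^2] each, in total [E (1/36 + E)]. *)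
  have h1 : (M - 4)%:R * E ^+ 2 <= M%:R * E ^+ 2.
    by rewrite ler_wpM2r ?sqr_ge0 // ler_nat leq_subr.
  have h2 : M%:R * E ^+ 2 <= (expR t / 36 + 1) * E ^+ 2 by rewrite ler_wpM2r ?sqr_ge0.
  have h3 : (expR t / 36 + 1) * E ^+ 2 = E * ((expR t * E) / 36 + E) by ring.
  rewrite EE in h3.
  have : E / 300 = E / 600 + E / 600 by lra.
  lra.
set Q := ((qden s)%:R ^+ 2)^-1 : R.
have Q0 : 0 < Q by rewrite invr_gt0 exprn_gt0.
have tail : ((qden s * qden (child s M))%:R)^-1 <= Q * (36 * E).
  have : ((qden s * qden (child s M))%:R)^-1 <= Q * M%:R^-1 :> R.
    have M0 : 0 < M%:R :> R by rewrite ltr0n (leq_trans _ M4).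
    have h1 : (qden s ^ 2 * M <= qden s * qden (child s M))%N.
      by rewrite /= -mulnn -mulnA leq_mul2l (mulnC (qden s)) leq_addr orbT.
    have h2 : (0 < qden s ^ 2 * M)%N.
      by rewrite muln_gt0 expn_gt0 q0 (leq_trans _ M4).
    rewrite /Q -invfM -natrX -natrM lef_pV2 ?posrE ?ltr0n ?(leq_trans h2 h1) //.
    by rewrite ler_nat.
  move/le_trans; apply; rewrite ler_wpM2l ?(ltW Q0) //.
  have M0 : 0 < M%:R :> R by rewrite ltr0n (leq_trans _ M4).
  rewrite -div1r ler_pdivrMr //.
  have : expR t / 36 * (36 * E) <= M%:R * (36 * E).
    by rewrite ler_wpM2r ?mulr_ge0 ?(ltW E0) // ltW.
  have -> : expR t / 36 * (36 * E) = expR t * E by lra.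
  rewrite EE; lra.
have -> : \sum_(1 <= c < M) C * expR (- ((t - ln (dratio s c)) * Num.sqrt (dratio s c)))
       * cyl_len (child s c) =
   C * Q * \sum_(1 <= c < M) expR (- ((t - ln (dratio s c)) * Num.sqrt (dratio s c))) *
     (dratio s c * (dratio s c + 1))^-1.
  rewrite mulr_sumr big_nat_cond [RHS]big_nat_cond.
  apply: eq_bigr => c /andP[/andP[c1 cM] _]; rewrite cyl_len_child // -/Q; ring.
pose r : R := (qden' s)%:R / (qden s)%:R.
have r0 : 0 <= r by rewrite divr_ge0.
have r1 : r <= 1 by rewrite ler_pdivrMr // mul1r ler_nat.
have e1 : dratio s 1%N = 1 + r.
  by rewrite /dratio /= mul1n natrD /r; field; rewrite gt_eqF.
have e2 : cyl_len s = Q * (1 + r)^-1.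
  rewrite /cyl_len /Q /r natrM natrD; field.
  by rewrite !gt_eqF // ltr_wpDr.
have CQ : 0 <= C * Q by rewrite mulr_ge0 ?(ltW Q0) //; lra.
have := ler_wpM2l CQ S; rewrite e1 e2 -/E => {}S.
apply: le_trans (lerD S tail) _.
have -> : C * Q * (E / (1 + r + 1) + E / 300 + E * (1 / 36 + E)) + Q * (36 * E) =
   (Q * E) * (C * ((1 + r + 1)^-1 + 1 / 300 + (1 / 36 + E)) + 36) by field; lra.
have -> : C * E * (Q * (1 + r)^-1) = (Q * E) * (C * (1 + r)^-1) by ring.
rewrite ler_wpM2l ?mulr_ge0 ?(ltW Q0) ?(ltW E0) //.
(* The gap is smallest at [r = 1], where it is [1/2 - 1/3]. It exceeds [1/300 + 1/36 + E + 36/C], as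
   [E <= 1/1001] and [C >= 1001]. *)
have h : (1 + r)^-1 >= (1 + r + 1)^-1 + 1 / 6.
  rewrite -subr_ge0.
  have -> : (1 + r)^-1 - ((1 + r + 1)^-1 + 1 / 6) =
     (4 + r) * (1 - r) / (6 * (1 + r) * (2 + r)).
    field; lra.
  by rewrite divr_ge0 ?mulr_ge0 //; lra.
have := ler_wpM2l (_ : 0 <= C) h => /(_ ltac:(lra)).
have := ler_wpM2l (_ : 0 <= C) E1 => /(_ ltac:(lra)).
rewrite !mulrDr; lra.
Qed.

(** Children with digit at least [M] all have offset below [1 / (q q_M)], so a finite union and one
    interval suffice. *)
Lemma bad_cover {R : realType} n s (t : R) (M : nat) : valid s -> 0 <= t -> (0 < M)%N ->
  bad n.+1 s t `<=`
  (\big[setU/set0]_(c < M.-1) bad n (child s c.+1)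
      ((t - ln (dratio s c.+1)) * Num.sqrt (dratio s c.+1)))
  `|` [set x | 0 < offset s x < ((qden s * qden (child s M))%:R)^-1].
Proof.
move=> vs t0 M0 x /=; rewrite ltNge t0 /= => -[c /= c0 h].
have vc := valid_child vs c0.
have [cM|Mc] := ltnP c M.
  left; case: c c0 h vc cM => // c _ h vc cM.
  rewrite -(prednK M0) ltnS in cM.
  rewrite -(bigcup_mkord M.-1 (fun c => bad n (child s c.+1)
      ((t - ln (dratio s c.+1)) * Num.sqrt (dratio s c.+1)))).
  by exists c.
right; have cx := bad_sub_cyl vc h.
have /andP[] := cyl_child_sub vs c0 cx; rewrite /= => -> _ /=.
have /andP[_ h2] := (cyl_child x vs c0).1 cx.
apply: lt_le_trans h2 _.
have [q0 qq _] := vs.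
rewrite lef_pV2 ?posrE ?ltr0n ?muln_gt0 ?q0 //=; last 2 first.
- by rewrite ltn_addr // muln_gt0 c0.
- by rewrite ltn_addr // muln_gt0 M0.
by rewrite ler_nat leq_mul2l leq_add2r leq_mul2r Mc !orbT.
Qed.

Lemma lebesgue_bad_le_cyl {R : realType} n s (t : R) : valid s ->
  (lebesgue_measure (bad n s t) <= (cyl_len s)%:E)%E.
Proof.
move=> vs; rewrite -lebesgue_cyl //; apply: le_measure; rewrite ?inE.
- exact: measurable_bad.
- exact: measurable_cyl.
- exact: bad_sub_cyl.
Qed.

(** For [t <= T] the factor [e^(T - t)] is at least 1 and the length of the cylinder suffices.
    Beyond [T], induction on [n] for all nodes and thresholds, with [cyl_len_sum_le] at [C = e^T],
    returns the same constant at every step. *)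
Lemma lebesgue_bad {R : realType} n s (T t : R) : valid s -> 1000 <= T ->
  (lebesgue_measure (bad n s t) <= (expR T * expR (- t) * cyl_len s)%:E)%E.
Proof.
move=> vs T1; have T0 : 0 <= T := le_trans (ler0n _ 1000) T1.
elim: n s t vs => [|n IH] s t vs; have [t1|t1] := leP t T.
1,3: apply: le_trans (lebesgue_bad_le_cyl _ _ vs) _.
1,2: by rewrite lee_fin ler_peMl ?cyl_len_ge0 // -expRD -[leLHS]expR0 ler_expR subr_ge0.
all: have t0 : 0 <= t by exact: le_trans T0 (ltW t1).
  rewrite /bad ltNge t0 /= measure0 lee_fin.
  by rewrite mulr_ge0 ?cyl_len_ge0 // mulr_ge0 ?expR_ge0.
pose M := (Num.truncn (expR t / 36)).+1.
pose B : set R := [set x | 0 < offset s x < ((qden s * qden (child s M))%:R)^-1].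
have mB : measurable B.
  by apply: measurable_offset => //; rewrite invr_ge0.
pose A (c : nat) : set R := bad n (child s c.+1)
      ((t - ln (dratio s c.+1)) * Num.sqrt (dratio s c.+1)).
have mA c : measurable (A c) by apply: measurable_bad; exact: valid_child.
apply: (@le_trans _ _ (lebesgue_measure ((\big[setU/set0]_(c < M.-1) A c)
  `|` B))).
  apply: le_measure; rewrite ?inE; [exact: measurable_bad| |exact: bad_cover].
  by apply: measurableU => //; apply: bigsetU_measurable => c _; exact: mA.
apply: (@le_trans _ _ (\sum_(c < M.-1) lebesgue_measure (A c) +
   lebesgue_measure B)%E).
  apply: le_trans (measureU2 _ _ _) _ => //.
    by apply: bigsetU_measurable => c _; exact: mA.
  by apply: leeD2r; apply: Boole_inequality => i _; exact: mA.
rewrite [X in (_ + X)%E]lebesgue_offset ?invr_ge0 //.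
apply: (@le_trans _ _ (\sum_(c < M.-1) (expR T *
   expR (- ((t - ln (dratio s c.+1)) * Num.sqrt (dratio s c.+1))) * cyl_len (child s c.+1))%:E
  + (((qden s * qden (child s M))%:R)^-1)%:E)%E).
  by apply: leeD2r; apply: lee_sum => c _; apply: IH; exact: valid_child.
rewrite sumEFin -EFinD lee_fin.
have := @cyl_len_sum_le R s t (expR T) M vs (le_trans T1 (ltW t1)) _ erefl.
rewrite big_add1 big_mkord; apply.
by apply: le_trans (expR_ge1Dx T); lra.
Qed.

Definition badU {R : realType} (s : node) (t : R) : set R :=
  \bigcup_n bad n s t.

Lemma measurable_badU {R : realType} s (t : R) : valid s -> measurable (badU s t).
Proof. by move=> vs; apply: bigcup_measurable => n _; exact: measurable_bad. Qed.

Lemma lebesgue_badU {R : realType} s (T t : R) : valid s -> 1000 <= T ->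
  (lebesgue_measure (badU s t) <= (expR T * expR (- t) * cyl_len s)%:E)%E.
Proof.
move=> vs T1.
have mb n : measurable (bad n s t) by exact: measurable_bad.
have nd : nondecreasing_seq (fun n => bad n s t).
  by apply/nondecreasing_seqP => n; apply/subsetPset; exact: badS.
have h := nondecreasing_cvg_mu (mu := @lebesgue_measure R) mb (measurable_badU t vs) nd.
rewrite -(cvg_lim _ h) //; apply: lime_le; first by apply/cvg_ex; eexists; exact: h.
by apply: nearW => n /=; exact: lebesgue_bad.
Qed.

Lemma not_badU {R : realType} n s (x t : R) : valid s -> not_frac x -> cyl s x ->
  ~ badU s t x -> chain_weight (fun k => qden (traj s x k)) n <= t.
Proof.
by move=> vs ix cx nb; apply: not_bad => // h; apply: nb; exists n.
Qed.

(** The coefficient of [t] stays exactly 1; only the error is relaxed, by [sqrt 2 <= 2]. *)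
Lemma F_near_fcenter_badU {R : realType} (K t : R) s x : perturb_const K -> valid s ->
  not_frac x -> cyl s x -> ~ badU s t x ->
  ((fseries x : nat -> R[i]^o) @ \oo --> (F x : R[i]^o)) /\
  normc (F x - fcenter (pnum s) (qden s)) <=
    (t + 972 * K) / Num.sqrt (2 * (qden s)%:R).
Proof.
move=> HK vs ix cx nb.
have ch := traj_chain vs ix cx.
have [h1 h2] := F_near_fcenter HK ch (fun n => not_badU n vs ix cx nb).
split => //; apply: le_trans h2 _; rewrite [leRHS]mulrDl lerD2l.
have [q0 _ _] := vs; have qr : 0 < (qden s)%:R :> R by rewrite ltr0n.
have s0 : 0 < Num.sqrt (qden s)%:R :> R by rewrite sqrtr_gt0.
have s2 : 0 < Num.sqrt 2 :> R by rewrite sqrtr_gt0.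
have s22 : Num.sqrt 2 <= 2 :> R.
  by rewrite -[leRHS]ger0_norm // -sqrtr_sqr ler_sqrt ?sqr_ge0 //; lra.
rewrite sqrtrM // ler_pdivlMr ?mulr_gt0 //.
have -> : 486 * K / Num.sqrt (qden s)%:R * (Num.sqrt 2 * Num.sqrt (qden s)%:R) =
  486 * K * Num.sqrt 2 by field; rewrite gt_eqF.
have -> : 972 * K = 486 * K * 2 by lra.
apply: ler_wpM2l; last exact: s22.
by apply: mulr_ge0; [exact: ler0n|exact: le_trans ler01 HK.1].
Qed.

(** * Measurability *)

(** A Cauchy criterion with countable quantifiers, so that the set of convergence is a countable
    combination of measurable sets. *)
Lemma real_seq_cauchyP {R : realType} (u : nat -> R) :
  cvgn u <-> forall k : nat, exists N, forall n, (N <= n)%N ->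
    `|u N - u n| <= k.+1%:R^-1.
Proof.
split=> [/cvg_ex[l /= ul] k|H].
  set d : R := k.+1%:R^-1; have d0 : 0 < d / 2 by rewrite divr_gt0 // invr_gt0.
  move/cvgrPdist_le : ul => /(_ _ d0) [N _ HN].
  exists N => n Nn; have /= h1 := HN N (leqnn N); have /= h2 := HN n Nn.
  have -> : u N - u n = (l - u n) - (l - u N) by ring.
  by rewrite (le_trans (ler_normB _ _)) // [leRHS](splitr d) lerD.
apply: cauchy_cvg; apply: cauchy_exP => eps e0.
have [N HN] := H (Num.truncn eps^-1).
exists (u N); exists N => // n Nn; apply: le_lt_trans (HN n Nn) _.
rewrite -[ltRHS]invrK ltf_pV2 ?posrE ?invr_gt0 ?ltr0n //; exact: truncnS_gt.
Qed.

Lemma measurable_cvgn {R : realType} (u : nat -> R -> R) :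
  (forall n, measurable_fun setT (u n)) ->
  measurable [set x | cvgn (u ^~ x)].
Proof.
move=> mu.
have -> : [set x | cvgn (u ^~ x)] =
    \bigcap_k \bigcup_N \bigcap_(n in [set n | (N <= n)%N])
      [set x | `|u N x - u n x| <= k.+1%:R^-1].
  apply/seteqP; split=> x /=.
    move/real_seq_cauchyP => H k _; have [N HN] := H k.
    by exists N => // n /= Nn; exact: HN.
  move=> H; apply/real_seq_cauchyP => k; have [N _ HN] := H k I.
  by exists N => n Nn; exact: HN.
apply: bigcap_measurable => [|k _]; first by exists 0%N.
apply: bigcup_measurable => N _; apply: bigcap_measurable => [|n _].
  by exists N => /=.
rewrite -[X in measurable X]setTI; apply: measurable_fun_le => //.
by apply: measurableT_comp => //; apply: measurable_funB.
Qed.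

Lemma measurable_lim {R : realType} (u : nat -> R -> R) (f : R -> R) (C : set R) (c : R) :
  (forall n, measurable_fun setT (u n)) -> measurable C ->
  (forall x, C x -> u ^~ x @ \oo --> f x) -> (forall x, ~ C x -> f x = c) ->
  measurable_fun setT f.
Proof.
move=> mu mC uf fc.
rewrite -(setvU C) setUC; apply/measurable_funU => //; first exact: measurableC.
split.
  by apply: (measurable_fun_cvg (h := u)) => // n; apply: measurable_funS (mu n).
apply: (eq_measurable_fun (cst c)) => [x|]; last exact: measurable_cst.
by rewrite inE => /fc ->.
Qed.

Lemma Re_fseries {R : realType} (x : R) n : complex.Re (fseries x n) =
  \sum_(1 <= m < n.+1) cos (2 * pi * ((m ^ 2)%:R * x)) / m%:R.
Proof.
rewrite /fseries (big_morph (@complex.Re R) (id1 := 0) (op1 := +%R)) //; last by case=> ? ? [].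
apply: eq_bigr => m _; rewrite -(rmorph_nat (real_complex R)) -fmorphV.
by rewrite /e /= mulr0 subr0.
Qed.

Lemma Im_fseries {R : realType} (x : R) n : complex.Im (fseries x n) =
  \sum_(1 <= m < n.+1) sin (2 * pi * ((m ^ 2)%:R * x)) / m%:R.
Proof.
rewrite /fseries (big_morph (@complex.Im R) (id1 := 0) (op1 := +%R)) //; last by case=> ? ? [].
apply: eq_bigr => m _; rewrite -(rmorph_nat (real_complex R)) -fmorphV.
by rewrite /e /= mulr0 add0r.
Qed.

Lemma measurable_trig_sum {R : realType} (g : R -> R) n : continuous g ->
  measurable_fun setT (fun x : R =>
    \sum_(1 <= m < n.+1) g (2 * pi * ((m ^ 2)%:R * x)) / m%:R).
Proof.
move=> cg; apply: measurable_sum => m; apply: measurable_funM => //.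
apply: measurableT_comp; first exact: continuous_measurable_fun.
by apply: measurable_funM => //; apply: measurable_funM.
Qed.

Lemma cvgc_parts {R : realType} (u : nat -> R[i]) (L : R[i]) :
  (u : nat -> R[i]^o) @ \oo --> (L : R[i]^o) ->
  (fun n => complex.Re (u n)) @ \oo --> complex.Re L /\
  (fun n => complex.Im (u n)) @ \oo --> complex.Im L.
Proof.
move=> uL.
have H (eps : R) : 0 < eps -> exists N, forall n, (N <= n)%N -> normc (L - u n) <= eps.
  move=> e0; have e0' : 0 < eps%:C :> R[i] by rewrite ltcR.
  move/cvgrPdist_le : uL => /(_ _ e0') [N _ HN]; exists N => n Nn.
  by have := HN n Nn; rewrite /= -[`|_|]/((normc (L - u n))%:C) lecR.
split; apply/cvgrPdist_le => eps /H [N HN]; exists N => // n /= /HN.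
  apply: le_trans; apply: le_trans (normr_Re_le _).
  by case: (L) (u n) => [a b] [c d].
apply: le_trans; apply: le_trans (normr_Im_le _).
by case: (L) (u n) => [a b] [c d].
Qed.

Lemma cvgc_of_parts {R : realType} (u : nat -> R[i]) :
  cvgn (fun n => complex.Re (u n)) -> cvgn (fun n => complex.Im (u n)) ->
  cvgn (u : nat -> R[i]^o).
Proof.
move=> /cvg_ex[a /= ca] /cvg_ex[b /= cb]; apply/cvg_ex; exists (a +i* b).
apply: cvgc_normP => eps e0.
have e2 : 0 < eps / 2 by rewrite divr_gt0.
move/cvgrPdist_le/(_ _ e2) : ca => [n1 _ H1].
move/cvgrPdist_le/(_ _ e2) : cb => [n2 _ H2].
exists (maxn n1 n2) => n; rewrite geq_max => /andP[/H1 /= h1 /H2 /= h2].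
move: (u n) h1 h2 => [c d] /= h1 h2.
by apply: le_trans (normc_le_ReIm ((a - c) +i* (b - d))) _ => /=; lra.
Qed.

Definition cvg_set {R : realType} : set R :=
  [set x | cvgn (fun n => complex.Re (fseries x n))] `&`
  [set x | cvgn (fun n => complex.Im (fseries x n))].

Lemma measurable_Re_fseries {R : realType} n :
  measurable_fun setT (fun x : R => complex.Re (fseries x n)).
Proof.
under eq_fun do rewrite Re_fseries.
exact: measurable_trig_sum (@continuous_cos R).
Qed.

Lemma measurable_Im_fseries {R : realType} n :
  measurable_fun setT (fun x : R => complex.Im (fseries x n)).
Proof.
under eq_fun do rewrite Im_fseries.
exact: measurable_trig_sum (@continuous_sin R).
Qed.

Lemma measurable_cvg_set {R : realType} : measurable (@cvg_set R).
Proof.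
apply: measurableI; apply: measurable_cvgn; [exact: measurable_Re_fseries|].
exact: measurable_Im_fseries.
Qed.

Lemma F_cvg {R : realType} (x : R) : cvg_set x ->
  (fseries x : nat -> R[i]^o) @ \oo --> (F x : R[i]^o).
Proof. by move=> [h1 h2]; exact: cvgc_of_parts. Qed.

Lemma F_dvg {R : realType} : exists c : R[i], forall x : R, ~ cvg_set x -> F x = c.
Proof.
(* The default value of the limit of a divergent sequence. *)
exists (@point (R[i]^o : pnbhsType)) => x nx.
have nc : ~ cvgn (fseries x : nat -> R[i]^o).
  apply: contra_not nx => /cvgc_parts[h1 h2].
  by split; apply/cvg_ex; eexists; [exact: h1|exact: h2].
exact: (dvgP nc).
Qed.

Lemma measurable_Re_F {R : realType} : measurable_fun setT (fun x : R => complex.Re (F x)).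
Proof.
have [c Fc] := @F_dvg R.
apply: (measurable_lim (u := fun n x => complex.Re (fseries x n)) (C := cvg_set)
  (c := complex.Re c)).
- exact: measurable_Re_fseries.
- exact: measurable_cvg_set.
- by move=> x /F_cvg /cvgc_parts[].
- by move=> x /Fc ->.
Qed.

Lemma measurable_Im_F {R : realType} : measurable_fun setT (fun x : R => complex.Im (F x)).
Proof.
have [c Fc] := @F_dvg R.
apply: (measurable_lim (u := fun n x => complex.Im (fseries x n)) (C := cvg_set)
  (c := complex.Im c)).
- exact: measurable_Im_fseries.
- exact: measurable_cvg_set.
- by move=> x /F_cvg /cvgc_parts[].
- by move=> x /Fc ->.
Qed.

(** * The average over an interval *)

Lemma countable_frac {R : realType} : countable (~` @not_frac R).
Proof.
apply: (@sub_countable _ _ _ (range (fun mn : nat * nat => mn.1%:R / mn.2%:R : R))).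
  apply: subset_card_le => x /= H; apply: contrapT => nx; apply: H => m n xE.
  by apply: nx; exists (m, n).
by apply: sub_countable (card_image_le _ _) _; exact: countableP.
Qed.

Lemma measurable_frac_sub {R : realType} (A : set R) : A `<=` ~` not_frac -> measurable A.
Proof.
move=> Af; apply: countable_measurable => //.
by apply: sub_countable countable_frac; exact: subset_card_le.
Qed.

Lemma lebesgue_frac {R : realType} : lebesgue_measure (~` @not_frac R) = 0%E.
Proof. exact/countable_lebesgue_measure0/countable_frac. Qed.

(** Equality with the cylinder off a countable set: measure and averages do not see the endpoints or
    the fractions inside. *)
Definition cyl_like {R : realType} (s : node) (I : set R) : Prop :=
  forall x, not_frac x -> (I x <-> cyl s x).

Lemma measurable_cyl_like {R : realType} s (I : set R) : valid s -> cyl_like s I ->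
  measurable I.
Proof.
move=> vs HI.
have mf : measurable (~` @not_frac R) by exact: measurable_frac_sub.
have -> : I = (cyl s `\` ~` not_frac) `|` (I `&` ~` not_frac).
  apply/seteqP; split=> x.
    move=> Ix; have [fx|nfx] := pselect (not_frac x); last by right.
    by left; split; [exact/HI|exact].
  by case=> [[cx /contrapT fx]|[]//]; exact/HI.
apply: measurableU; last by apply: measurable_frac_sub => x [].
by apply: measurableD => //; exact: measurable_cyl.
Qed.

Lemma lebesgue_cyl_like {R : realType} s (I : set R) : valid s -> cyl_like s I ->
  lebesgue_measure I = (cyl_len s)%:E.
Proof.
move=> vs HI; have mI := measurable_cyl_like vs HI.
have mf : measurable (~` @not_frac R) by exact: measurable_frac_sub.
have mc := @measurable_cyl R s vs.
have H (A B : set R) : measurable A -> measurable B ->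
    (forall x, not_frac x -> A x -> B x) ->
    (lebesgue_measure A <= lebesgue_measure B)%E.
  move=> mA mB AB; apply: (@le_trans _ _ (lebesgue_measure (B `|` ~` not_frac))).
    apply: le_measure; rewrite ?inE //; first exact: measurableU.
    by move=> x Ax; have [fx|] := pselect (not_frac x); [left; exact: AB|right].
  apply: le_trans (measureU2 _ _ _) _ => //.
  by rewrite [X in (_ + X)%E]lebesgue_frac adde0.
rewrite -lebesgue_cyl //; apply/eqP; rewrite eq_le; apply/andP; split; apply: H => // x fx.
  by move/HI; exact.
by move=> cx; apply/HI.
Qed.

(** The deviation of the mean from [c] is the mean of [f - c]; the bound on the integral of its
    modulus also supplies integrability. *)
Lemma Rintegral_near {R : realType} (I : set R) (f : R -> R) (c l B : R) :
  measurable I -> lebesgue_measure I = l%:E -> 0 < l -> measurable_fun I f ->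
  (\int[lebesgue_measure]_(x in I) (`|f x - c|%:E) <= (B * l)%:E)%E ->
  `|l^-1 * (\int[lebesgue_measure]_(x in I) f x)%R - c| <= B.
Proof.
move=> mI lI l0 mf hB.
have ic : lebesgue_measure.-integrable I (EFin \o (fun=> c)).
  apply/integrableP; split; first exact/measurable_EFinP.
  rewrite (eq_integral (cst (`|c|%:E))) // integral_cst // [X in (_ * X < _)%E]lI.
  by rewrite -EFinM ltry.
have ifc : lebesgue_measure.-integrable I (EFin \o (fun x => f x - c)).
  apply/integrableP; split; last by apply: le_lt_trans hB _; rewrite ltry.
  by apply/measurable_EFinP; apply: measurable_funB.
have -> : (\int[lebesgue_measure]_(x in I) f x)%R =
   (\int[lebesgue_measure]_(x in I) (f x - c))%R + c * l.
  have -> : c * l = (\int[lebesgue_measure]_(x in I) c)%R.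
    by rewrite Rintegral_cst // [X in fine X]lI.
  rewrite -RintegralD //; congr fine; apply: eq_integral => x _ /=.
  by rewrite subrK.
rewrite mulrDr [l^-1 * (c * l)]mulrC mulfK ?gt_eqF // addrK normrM.
rewrite ger0_norm ?invr_ge0 ?(ltW l0) // ler_pdivrMl // [leRHS]mulrC.
apply: le_trans (le_normr_Rintegral (mu := lebesgue_measure) mI ifc) _.
rewrite /Rintegral -lee_fin fineK //.
rewrite ge0_fin_numE; first by apply: le_lt_trans hB _; rewrite ltry.
by apply: integral_ge0 => x _; rewrite lee_fin.
Qed.

Lemma sum_half_le {R : realType} n : \sum_(i < n) (2^-1) ^+ i <= 2 :> R.
Proof.
have -> : \sum_(i < n) (2^-1) ^+ i = 2 - 2 * 2^-1 ^+ n :> R.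
  elim: n => [|n IH]; first by rewrite big_ord0 expr0; lra.
  by rewrite big_ord_recr /= IH exprS; lra.
by rewrite lerBlDr lerDl mulr_ge0 // exprn_ge0 // invr_ge0.
Qed.

Lemma expRN_nat_le {R : realType} j : expR (- j%:R) <= (2^-1) ^+ j :> R.
Proof.
have -> : - j%:R = j%:R * (- 1) :> R by ring.
rewrite expRM_natl lerXn2r ?nnegrE ?expR_ge0 ?invr_ge0 //.
rewrite expRN lef_pV2 ?posrE ?expR_gt0 //.
by have := expR_ge1Dx (1 : R); lra.
Qed.

(** A discrete layer-cake function: the number of integer levels [j] with [x] in [badU s j],
    possibly infinite. *)
Definition bad_count {R : realType} (s : node) (x : R) : \bar R :=
  (\sum_(j <oo) (\1_(badU s j%:R) x)%:E)%E.

Lemma bad_count_ge0 {R : realType} s (x : R) : (0 <= bad_count s x)%E.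
Proof. by apply: nneseries_ge0 => n _ _; rewrite lee_fin. Qed.

Lemma measurable_bad_count {R : realType} s (I : set R) : valid s -> measurable I ->
  measurable_fun I (bad_count s).
Proof.
move=> vs mI; refine (ge0_emeasurable_sum (P := predT)
  (h := fun j x => (\1_(badU s j%:R) x)%:E) _ _) => [k x _ _|k _].
  by rewrite lee_fin.
apply/measurable_EFinP; apply: measurable_funTS; apply: measurable_indic.
exact: measurable_badU.
Qed.

(** Integrate term by term; the measures decay like [e^(-j) <= 2^(-j)], with sum at most 2. *)
Lemma integral_bad_count {R : realType} s (I : set R) (T : R) : valid s ->
  cyl_like s I -> 1000 <= T ->
  (\int[lebesgue_measure]_(x in I) bad_count s x <= (2 * expR T * cyl_len s)%:E)%E.
Proof.
move=> vs HI T1; have mI := measurable_cyl_like vs HI.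
have mf n : measurable_fun I (fun x => (\1_(badU s n%:R) x)%:E : \bar R).
  apply/measurable_EFinP; apply: measurable_funTS; apply: measurable_indic.
  exact: measurable_badU.
have f0 n x : I x -> (0 <= (\1_(badU s n%:R) x : R)%:E)%E by rewrite lee_fin.
rewrite (integral_nneseries lebesgue_measure mI mf f0).
apply: lime_le.
  apply: is_cvg_ereal_nneg_natsum => n _.
  by apply: integral_ge0 => x _; rewrite lee_fin.
apply: nearW => n.
apply: (@le_trans _ _ (\sum_(0 <= j < n) (expR T * cyl_len s * (2^-1) ^+ j)%:E)%E).
  apply: lee_sum => j _; rewrite integral_indic //; last exact: measurable_badU.
  apply: (@le_trans _ _ (lebesgue_measure (badU s j%:R : set R))).
    apply: le_measure; rewrite ?inE; [|exact: measurable_badU|exact: subIsetl].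
    by apply: measurableI => //; exact: measurable_badU.
  apply: le_trans (lebesgue_badU _ vs T1) _; rewrite lee_fin.
  rewrite [leRHS]mulrAC ler_wpM2r ?cyl_len_ge0 // ler_wpM2l ?expR_ge0 //.
  exact: expRN_nat_le.
rewrite sumEFin lee_fin big_mkord -mulr_sumr.
have := ler_wpM2l (mulr_ge0 (expR_ge0 T) (@cyl_len_ge0 R s)) (@sum_half_le R n).
by move/le_trans; apply; rewrite mulrC mulrA.
Qed.

Lemma F_le_bad_count {R : realType} (K : R) s (x : R) : perturb_const K -> valid s ->
  not_frac x -> cyl s x ->
  ((normc (F x - fcenter (pnum s) (qden s)) * Num.sqrt (2 * (qden s)%:R))%:E
    <= (972 * K)%:E + bad_count s x)%E.
Proof.
move=> HK vs fx cx; set y := normc _ * _.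
have [q0 _ _] := vs.
have r0 : 0 < Num.sqrt (2 * (qden s)%:R) :> R by rewrite sqrtr_gt0 mulr_gt0 // ltr0n.
have [n [yn Hn]] : exists n : nat, y <= n%:R + 972 * K /\
    forall i, (i < n)%N -> badU s i%:R x.
  (* Take the first level that [x] escapes. If there is none, any [n] above [y] works, since all
     earlier levels contain [x]. *)
  have [ex|nex] := pselect (exists j : nat, ~ badU s j%:R x); last first.
    exists (Num.truncn y).+1; split.
      apply: le_trans (ltW (truncnS_gt y)) _; rewrite lerDl.
      by apply: mulr_ge0; [exact: ler0n|exact: le_trans ler01 HK.1].
    by move=> i _; apply: contrapT => h; apply: nex; exists i.
  have ex' : exists j : nat, `[< ~ badU s j%:R x >].
    by have [j hj] := ex; exists j; apply/asboolP.
  case: (ex_minnP ex') => j /asboolP hj minj; exists j; split.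
    rewrite /y -ler_pdivlMr //.
    by have [_] := F_near_fcenter_badU HK vs fx cx hj.
  move=> i ij; apply: contrapT => h.
  by have := minj i (introT (asboolP _) h); rewrite leqNgt ij.
have h : (n%:R%:E <= bad_count s x)%E.
  apply: (@le_trans _ _ (\sum_(0 <= j < n) (\1_(badU s j%:R) x)%:E)%E); last first.
    by apply: nneseries_lim_ge => j _ _; rewrite lee_fin.
  rewrite sumEFin lee_fin.
  rewrite (_ : n%:R = \sum_(0 <= j < n) 1); last first.
    by rewrite big_const_nat iter_addr_0 subn0.
  rewrite big_nat_cond [leRHS]big_nat_cond; apply: ler_sum => j /andP[/andP[_ jn] _].
  by rewrite indicE mem_set //; exact: Hn.
apply: (@le_trans _ _ ((972 * K)%:E + n%:R%:E)%E); last by rewrite leeD2l.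
by rewrite -EFinD lee_fin addrC.
Qed.

(** Here [g] stands for the real or the imaginary part. *)
Lemma integral_F_le {R : realType} (K T : R) s (I : set R) (g : R[i] -> R) :
  perturb_const K -> valid s -> cyl_like s I -> 1000 <= T ->
  (forall z, `|g z| <= normc z) -> (forall z w, g (z - w) = g z - g w) ->
  measurable_fun setT (fun x => g (F x)) ->
  (\int[lebesgue_measure]_(x in I)
     (`|g (F x) - g (fcenter (pnum s) (qden s))|%:E) <=
  ((972 * K + 2 * expR T) / Num.sqrt (2 * (qden s)%:R) * cyl_len s)%:E)%E.
Proof.
move=> HK vs HI T1 gn gB mg; have mI := measurable_cyl_like vs HI.
have [q0 _ _] := vs.
have r0 : 0 < Num.sqrt (2 * (qden s)%:R) :> R by rewrite sqrtr_gt0 mulr_gt0 // ltr0n.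
set r := Num.sqrt _ in r0 *.
have K0 : 0 <= 972 * K.
  by apply: mulr_ge0; [exact: ler0n|exact: le_trans ler01 HK.1].
have HF x fx cx := @F_le_bad_count R K s x HK vs fx cx.
move: (972 * K) K0 HF => k k0 HF.
apply: (@le_trans _ _ (\int[lebesgue_measure]_(x in I)
   ((r^-1)%:E * (k%:E + bad_count s x)))%E).
  apply: ae_ge0_le_integral => //.
  - apply/measurable_EFinP; apply: measurable_funTS.
    by apply: measurableT_comp => //; apply: measurable_funB.
  - move=> x _; rewrite mule_ge0 ?lee_fin ?invr_ge0 ?(ltW r0) //.
    by rewrite adde_ge0 ?lee_fin ?bad_count_ge0.
  - apply: emeasurable_funM => //; apply: emeasurable_funD => //.
    exact: measurable_bad_count.
  - exists (~` not_frac); split; [exact: measurable_frac_sub|exact: lebesgue_frac|].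
    move=> x /= h fx; apply: h => Ix; have cx := (HI x fx).1 Ix.
    rewrite lee_pdivlMl // -EFinM.
    apply: le_trans (HF x fx cx).
    by rewrite lee_fin mulrC ler_wpM2r ?(ltW r0) // -gB.
rewrite ge0_integralZl_EFin ?invr_ge0 ?(ltW r0) //; last 2 first.
- by move=> x _; rewrite adde_ge0 ?lee_fin ?bad_count_ge0.
- by apply: emeasurable_funD => //; exact: measurable_bad_count.
rewrite ge0_integralD //; last 2 first.
- by move=> x _; exact: bad_count_ge0.
- exact: measurable_bad_count.
rewrite integral_cst // [X in (_ * (_ * X + _) <= _)%E](lebesgue_cyl_like vs HI).
apply: (@le_trans _ _ ((r^-1)%:E * (k%:E * (cyl_len s)%:E +
   (2 * expR T * cyl_len s)%:E))%E).
  rewrite lee_pmul2l ?lte_fin ?invr_gt0 // leeD2l //.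
  exact: integral_bad_count.
rewrite -!(EFinM, EFinD) lee_fin le_eqVlt; apply/orP; left; apply/eqP; field.
by rewrite gt_eqF.
Qed.

(** The leading factor 2 comes from adding the real and imaginary parts. *)
Lemma average_near {R : realType} (K T : R) s (I : set R) :
  perturb_const K -> valid s -> cyl_like s I -> 1000 <= T ->
  normc (average I (@F R) - fcenter (pnum s) (qden s)) <=
  2 * (972 * K + 2 * expR T) / Num.sqrt (2 * (qden s)%:R).
Proof.
move=> HK vs HI T1; have mI := measurable_cyl_like vs HI.
have lI := lebesgue_cyl_like vs HI.
have l0 := @cyl_len_gt0 R s vs.
have hre := Rintegral_near mI lI l0 (measurable_funTS measurable_Re_F)
  (integral_F_le HK vs HI T1 (@normr_Re_le R) (fun z w => ltac:(by case: z w => [? ?] [? ?])) measurable_Re_F).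
have him := Rintegral_near mI lI l0 (measurable_funTS measurable_Im_F)
  (integral_F_le HK vs HI T1 (@normr_Im_le R) (fun z w => ltac:(by case: z w => [? ?] [? ?])) measurable_Im_F).
rewrite /average /cintegral [X in fine X]lI.
apply: le_trans (normc_le_ReIm _) _.
move: (fcenter _ _) hre him => [a b] /= hre him.
rewrite !mul0r subr0 addr0; lra.
Qed.

(** * Continued fraction intervals *)

(** The formal convergents [0/1] and [1/0] that start the recurrence. *)
Definition root_node : node := Node 0 1 1 0.

Lemma valid_root : valid root_node.
Proof. by split => //; left. Qed.

(** The value of an expansion that passes through [s] and continues with tail [y] in [[0, 1]]. *)
Definition mob {R : realType} (s : node) (y : R) : R :=
  ((pnum s)%:R + (pnum' s)%:R * y) / ((qden s)%:R + (qden' s)%:R * y).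

Lemma mob_root {R : realType} (y : R) : mob root_node y = y.
Proof. by rewrite /mob /= mul1r mul0r addr0 add0r divr1. Qed.

Lemma mob0 {R : realType} s : mob s (0 : R) = (pnum s)%:R / (qden s)%:R.
Proof. by rewrite /mob !mulr0 !addr0. Qed.

Lemma mob_child {R : realType} s c (y : R) : valid s -> (0 < c)%N -> 0 <= y ->
  mob s (c%:R + y)^-1 = mob (child s c) y.
Proof.
move=> [q0 _ _] c0 y0.
have cr : 1 <= c%:R :> R by rewrite ler1n.
have qr : 0 < (qden s)%:R :> R by rewrite ltr0n.
have q'r : 0 <= (qden' s)%:R :> R by [].
have cy : 0 < c%:R + y by lra.
have h : 0 < (c%:R + y) * (qden s)%:R + (qden' s)%:R by rewrite ltr_wpDr // mulr_gt0.
rewrite /mob /= !natrD !natrM; field.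
rewrite !gt_eqF //=.
by apply: lt_le_trans h _; rewrite le_eqVlt; apply/orP; left; apply/eqP; ring.
Qed.

Lemma cfrac_itv {R : realType} b : all (leq 1) b -> 0 <= cfrac R b <= 1.
Proof.
elim: b => [|c b IH] /=; first by rewrite lexx ler01.
move=> /andP[c0 /IH /andP[h0 h1]]; have cr : 1 <= c%:R :> R by rewrite ler1n.
by rewrite invr_ge0 addr_ge0 //= invf_le1; lra.
Qed.

Definition node_of (a : seq nat) : node := foldl child root_node a.

Lemma valid_foldl s a : valid s -> all (leq 1) a -> valid (foldl child s a).
Proof.
elim: a s => //= c a IH s vs /andP[c0 ha]; apply: IH => //; exact: valid_child.
Qed.

Lemma mob_cfrac {R : realType} s a b : valid s -> all (leq 1) a -> all (leq 1) b ->
  mob s (cfrac R (a ++ b)) = mob (foldl child s a) (cfrac R b).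
Proof.
elim: a s => //= c a IH s vs /andP[c0 ha] hb.
rewrite mob_child //; first by apply: IH => //; exact: valid_child.
by have /andP[] := @cfrac_itv R (a ++ b) (etrans (all_cat _ _ _) (introT andP (conj ha hb))).
Qed.

Lemma cfrac_cat {R : realType} a b : all (leq 1) a -> all (leq 1) b ->
  cfrac R (a ++ b) = mob (node_of a) (cfrac R b).
Proof.
by move=> ha hb; rewrite -[LHS]mob_root mob_cfrac //; exact: valid_root.
Qed.

Lemma cfrac_node {R : realType} a : all (leq 1) a ->
  cfrac R a = (pnum (node_of a))%:R / (qden (node_of a))%:R.
Proof. by move=> ha; rewrite -mob0 -[in LHS](cats0 a) cfrac_cat. Qed.

(** Both fractions are in lowest terms, so the denominator is the same for either expansion of
    [p/q]. *)
Lemma qden_node {R : realType} (p q : nat) a : (0 < q)%N -> coprime p q ->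
  all (leq 1) a -> p%:R / q%:R = cfrac R a -> qden (node_of a) = q.
Proof.
move=> q0 pq ha; rewrite cfrac_node //.
have vs := valid_foldl valid_root ha; have [Q0 _ _] := vs.
have PQ := valid_coprime vs.
move: (pnum _) (qden _) Q0 PQ => P Q Q0 PQ /eqP.
rewrite eqr_div ?pnatr_eq0 -?lt0n // -!natrM eqr_nat => /eqP E.
apply/eqP; rewrite eqn_dvd; apply/andP; split.
  by rewrite -(@Gauss_dvdr Q P) 1?coprime_sym // -E dvdn_mull.
by rewrite -(@Gauss_dvdr q p) 1?coprime_sym // E dvdn_mull.
Qed.

(** The offset equals [y / (q (q + q' y))], which reaches [cyl_len s] at [y = 1]. *)
Lemma offset_mob {R : realType} s (y : R) : valid s -> 0 <= y <= 1 ->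
  0 <= offset s (mob s y) <= cyl_len s.
Proof.
move=> vs /andP[y0 y1]; have [q0 _ _] := vs.
have qr : 0 < (qden s)%:R :> R by rewrite ltr0n.
have q'r : 0 <= (qden' s)%:R :> R by [].
have qy : 0 < (qden s)%:R + (qden' s)%:R * y by rewrite ltr_wpDr // mulr_ge0.
have -> : offset s (mob s y) =
    y / ((qden s)%:R * ((qden s)%:R + (qden' s)%:R * y)).
  have -> : offset s (mob s y) =
     sgn s * sgn s * (y / ((qden s)%:R * ((qden s)%:R + (qden' s)%:R * y))).
    by rewrite /offset /mob /sgn; field; rewrite !gt_eqF.
  by rewrite sgn_sqr // mul1r.
rewrite divr_ge0 ?mulr_ge0 ?(ltW qr) ?(ltW qy) //= /cyl_len natrM natrD.
have qq : 0 < (qden s)%:R + (qden' s)%:R :> R by rewrite ltr_wpDr.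
rewrite ler_pdivrMr ?mulr_gt0 // ler_pdivlMl ?mulr_gt0 // -mulrA ler_pM2l //.
rewrite mulrDl lerD2r; exact: ler_piMr (ltW qr) y1.
Qed.

Lemma continuous_offset {R : realType} s : continuous (@offset R s).
Proof. by move=> x; apply: cvgM; [exact: cvg_cst|apply: cvgB; [exact: cvg_id|exact: cvg_cst]]. Qed.

Lemma not_frac_offset {R : realType} s (x : R) : valid s -> not_frac x ->
  0 <= offset s x <= cyl_len s -> cyl s x.
Proof.
move=> vs fx /andP[h0 h1]; rewrite /cyl /=; apply/andP.
have [q0 _ _] := vs.
have qr : 0 < (qden s)%:R :> R by rewrite ltr0n.
have q'r : 0 <= (qden' s)%:R :> R by [].
have qq : 0 < (qden s)%:R + (qden' s)%:R :> R by rewrite ltr_wpDr.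
have xE : x = (pnum s)%:R / (qden s)%:R + sgn s * offset s x.
  by rewrite mulrA sgn_sqr // mul1r addrC subrK.
split; rewrite lt_neqAle ?h0 ?h1 andbT; apply/eqP.
  by move=> /esym o0; apply: (fx (pnum s) (qden s)); rewrite [LHS]xE o0 mulr0 addr0.
move=> o1; apply: (fx (pnum s + pnum' s)%N (qden s + qden' s)%N).
rewrite [LHS]xE o1 natrM !natrD /sgn; field.
by rewrite !gt_eqF.
Qed.

(** A finite continuation gives a fraction. For an infinite one the closed bounds of [offset_mob]
    pass to the limit, and become strict because the endpoints are fractions. *)
Lemma cf_interval_sub {R : realType} a (x : R) : all (leq 1) a -> not_frac x ->
  cf_interval R a x -> cyl (node_of a) x.
Proof.
move=> ha fx [_ [[b [hb xE]]|[b [hb bx]]]].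
  exfalso; have hab : all (leq 1) (a ++ b) by rewrite all_cat ha.
  by apply: (fx (pnum (node_of (a ++ b))) (qden (node_of (a ++ b)))); rewrite -cfrac_node.
have vs := valid_foldl valid_root ha.
apply: not_frac_offset => //.
have hm n : all (leq 1) (mkseq b n).
  by apply/allP => c /mapP[k _ ->]; exact: hb.
have hn n : 0 <= offset (node_of a) (cfrac R (a ++ mkseq b n)) <= cyl_len (node_of a).
  by rewrite cfrac_cat //; apply: offset_mob => //; exact: cfrac_itv.
have ox : offset (node_of a) (cfrac R (a ++ mkseq b n)) @[n --> \oo] --> offset (node_of a) x.
  exact: (continuous_cvg _ (@continuous_offset R _ x) bx).
apply/andP; split.
  rewrite -(cvg_lim _ ox) //; apply: limr_ge; first by apply/cvg_ex; eexists; exact: ox.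
  by apply: nearW => n; have /andP[] := hn n.
rewrite -(cvg_lim _ ox) //; apply: limr_le; first by apply/cvg_ex; eexists; exact: ox.
by apply: nearW => n; have /andP[] := hn n.
Qed.

Lemma foldl_traj {R : realType} s (x : R) n : valid s -> not_frac x -> cyl s x ->
  foldl child s (mkseq (fun k => digit (traj s x k) x) n) = traj s x n.
Proof.
move=> vs fx cx; elim: n => [//|n IH].
rewrite /mkseq -[n.+1]addn1 iotaD map_cat foldl_cat [foldl _ s _]IH add0n addn1.
by have [_ _ _ ->] := trajP n vs fx cx.
Qed.

Lemma cyl_foldl_sub {R : realType} s a : valid s -> all (leq 1) a ->
  cyl (foldl child s a) `<=` @cyl R s.
Proof.
elim: a s => [s _ _ //|c a IH s vs /= /andP[c0 ha] x hx].
by apply: (cyl_child_sub vs c0); apply: (IH _ (valid_child vs c0) ha).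
Qed.

Lemma sub_cf_interval {R : realType} a (x : R) : all (leq 1) a -> not_frac x ->
  cyl (node_of a) x -> cf_interval R a x.
Proof.
move=> ha fx cx; have vs := valid_foldl valid_root ha.
split.
  (* The cylinder of the root is [(0, 1)]. *)
  have := cyl_foldl_sub valid_root ha cx; rewrite /cyl /= /offset /sgn /=.
  by rewrite !(mul0r, mul1r, mulr0, mulr1, subr0) invr1 => /andP[/ltW -> ->].
right; exists (fun k => digit (traj (node_of a) x k) x); split.
  by move=> n; have [] := trajP n vs fx cx.
have ch := traj_chain vs fx cx.
apply/cvgrPdist_le => eps e0.
(* From index [2 N] on the denominators are at least [N > 1 / eps], hence the convergents are within
   [eps] of [x]. *)
pose N := (Num.truncn eps^-1).+1.
exists (2 * N)%N => // n /= nN.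
have hm : all (leq 1) (mkseq (fun k => digit (traj (node_of a) x k) x) n).
  by apply/allP => c /mapP[k _ ->]; have [] := trajP k vs fx cx.
rewrite cfrac_cat // -[cfrac R (mkseq _ _)]/(cfrac R _) -[mkseq _ n]cats0.
rewrite mob_cfrac // mob0 foldl_traj //.
apply: le_trans (chain_approx ch n) _.
have q0 k : (0 < qden (traj (node_of a) x k))%N := chain_gt0 ch k.
have Nq : (N <= qden (traj (node_of a) x n) * qden (traj (node_of a) x n.+1))%N.
  rewrite (leq_trans (chain_ge ch N)) // (leq_trans (chain_leq ch nN)) //.
  by rewrite leq_pmulr.
apply: (@le_trans _ _ (N%:R^-1)).
  by rewrite lef_pV2 ?posrE ?ltr0n ?muln_gt0 ?q0 // ler_nat.
rewrite -[leRHS]invrK lef_pV2 ?posrE ?invr_gt0 ?ltr0n //.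
exact/ltW/truncnS_gt.
Qed.

Theorem theorem3p2 (R : realType) :
  exists C : R, 0 < C /\
    forall (p q : nat) (a : seq nat) (lambda : R),
      (0 < q)%N -> coprime p q ->
      all (leq 1) a -> p%:R / q%:R = cfrac R a ->
      0 < lambda ->
      let I := cf_interval R a in
      (lebesgue_measure
         [set x | I x /\ (lambda%:C < `|F x - average I (@F R)|)%R]
       <= C%:E * lebesgue_measure I
          * (expR (- lambda * Num.sqrt (2 * q%:R)))%:E)%E.
Proof.
have [K HK] := @perturb_const_exists R.
have [T T1] : exists T : R, 1000 <= T by exists 1000.
(* The sum of the errors: [972 K] from [F] and twice [972 K + 2 e^T] from the average. *)
pose K' := 3 * (972 * K) + 4 * expR T.
exists (expR (T + K')); split; first exact: expR_gt0.
move=> p q a lambda q0 pq ha pqa _; cbv zeta; set I := cf_interval R a.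
pose s := node_of a.
have vs : valid s := valid_foldl valid_root ha.
have qs : qden s = q := qden_node q0 pq ha pqa.
have HI : cyl_like s I.
  by move=> x fx; split; [exact: cf_interval_sub|exact: sub_cf_interval].
set r := Num.sqrt (2 * q%:R).
have r0 : 0 < r by rewrite sqrtr_gt0 mulr_gt0 // ltr0n.
(* With this level, off [badU s t] the two errors add up to exactly [lambda]. It may be negative,
   which [lebesgue_badU] allows. *)
pose t := lambda * r - K'.
have hav := average_near HK vs HI T1; rewrite qs -/r in hav.
have sub : [set x | I x /\ (lambda%:C < `|F x - average I (@F R)|)%R] `<=`
    badU s t `|` ~` not_frac.
  move=> x /= [Ix hx]; have [fx|] := pselect (not_frac x); last by right.
  left; apply: contrapT => nb; have cx := (HI x fx).1 Ix.
  have [_ hF] := F_near_fcenter_badU HK vs fx cx nb; rewrite qs -/r in hF.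
  move: hx; rewrite -[`|_|]/((normc (F x - average I (@F R)))%:C) ltcR ltNge => /negP; apply.
  have -> : F x - average I (@F R) = (F x - fcenter (pnum s) (qden s))
     - (average I (@F R) - fcenter (pnum s) (qden s)) by ring.
  rewrite qs; apply: le_trans (le_normcD _ _) _; rewrite normcN.
  apply: le_trans (lerD hF hav) _.
  rewrite -mulrDl ler_pdivrMr // /t /K'.
  by move: (972 * K) => k; lra.
apply: (@le_trans _ _ (lebesgue_measure (badU s t `|` ~` not_frac))).
  (* Monotonicity of the outer measure asks for no measurability of the exceptional set. *)
  exact: le_outer_measure.
apply: le_trans (outer_measureU2 _ _ _) _.
rewrite [X in (_ + X <= _)%E]lebesgue_frac adde0.
apply: le_trans (lebesgue_badU _ vs T1) _.
rewrite [X in (_ * X * _)%E](lebesgue_cyl_like vs HI) -!EFinM lee_fin.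
rewrite le_eqVlt; apply/orP; left; apply/eqP.
(* The exponents agree: [T - t = T + K' - lambda r]. *)
rewrite [RHS]mulrAC -!expRD; congr (expR _ * _).
by rewrite /t; ring.
Qed.
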